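(* Let $\Omega=\bigcup_{i=1}^n(\alpha_i,\beta_i)$ with $-\infty<\alpha_1<\beta_1<\alpha_2<\beta_2<\dots<\alpha_n<\beta_n<\infty$, and let $\mathsf{D}=\frac1{2\pi \mathrm{i}}\frac{d}{dx}$ on $C_c^\infty(\Omega)$. For every self-adjoint extension $A$ of $\mathsf{D}$ there exists a unique $n\times n$ unitary matrix $B$ such that $A$ is the restriction of $\mathsf{D}^*$ to $$\mathcal{D}_B:=\{f\in\mathcal{D}_{\max}: Bf(\alpha)=f(\beta)\}.$$ Conversely, for any $n\times n$ unitary matrix $B$, the restriction of $\mathsf{D}^*$ to $\mathcal{D}_B$ is a self-adjoint extension of $\mathsf{D}$.
   Context: The Hilbert space is $L^2(\Omega)$ with Lebesgue measure. $\mathsf{D}f=\frac1{2\pi \mathrm{i}}f'$ with domain $C_c^\infty(\Omega)$ is symmetric; its adjoint $\mathsf{D}^*$ has domain $\mathcal{D}_{\max}=\{f:\Omega\to\mathbb{C}: f\in L^2(\Omega)\text{ is absolutely continuous on each }(\alpha_i,\beta_i),\ f'\in L^2(\Omega)\}$ and $\mathsf{D}^*f=\frac1{2\pi \mathrm{i}}f'$. For $f\in\mathcal{D}_{\max}$, $f(\alpha_i)=\lim_{x\downarrow\alpha_i}f(x)$ and $f(\beta_i)=\lim_{x\uparrow\beta_i}f(x)$ exist, and $f(\alpha)=(f(\alpha_1),\dots,f(\alpha_n))^t$, $f(\beta)=(f(\beta_1),\dots,f(\beta_n))^t\in\mathbb{C}^n$. *)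

(* Defs.v *)
From HB Require Import structures.
From mathcomp Require Import all_boot all_order all_algebra generic_quotient.
From mathcomp Require Import ring_quotient spectral ring lra.
From mathcomp Require Import all_classical all_reals all_analysis.
From mathcomp Require Import measurable_realfun.
From mathcomp Require Import complex.

Set Implicit Arguments.
Unset Strict Implicit.
Unset Printing Implicit Defensive.

Import Order.TTheory GRing.Theory Num.Theory numFieldNormedType.Exports.
Import complex.ComplexField.Normc.

Local Notation Re := complex.Re.
Local Notation Im := complex.Im.

Local Open Scope classical_set_scope.
Local Open Scope ring_scope.
Local Open Scope quotient_scope.

(* Complex-valued square-integrable functions on a measure space, and the
   Hilbert space L^2(mu) obtained by identifying functions that agree a.e. *)

Section L2.
Context d (T : measurableType d) (R : realType).
Variable mu : {measure set T -> \bar R}.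
Local Notation C := R[i].
Implicit Types (f g h : T -> C) (c : C).

Definition cmeasurable f :=
  measurable_fun setT (fun x => Re (f x)) /\
  measurable_fun setT (fun x => Im (f x)).

Definition square_integrable f :=
  cmeasurable f /\ (\int[mu]_x (normc (f x) ^+ 2)%:E < +oo)%E.

Definition L2pred : {pred T -> C} := [pred f | `[< square_integrable f >]].

Lemma L2predP f : reflect (square_integrable f) (f \in L2pred).
Proof. exact: asboolP. Qed.

Let normc2 (z : C) : normc z ^+ 2 = Re z ^+ 2 + Im z ^+ 2.
Proof. by case: z => a b; rewrite sqr_sqrtr// addr_ge0 ?sqr_ge0. Qed.

Let cmeasurable_sqr f : cmeasurable f ->
  measurable_fun setT (EFin \o (fun x => normc (f x) ^+ 2)).
Proof.
move=> [mr mi]; apply/measurable_EFinP; rewrite /comp.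
under eq_fun do rewrite normc2.
by apply: measurable_funD; exact: measurable_funX.
Qed.

Lemma L2_submod_closed : submod_closed L2pred.
Proof.
split.
  apply/L2predP; split; first by split; exact: measurable_cst.
  rewrite integral0_eq// => x _ /=.
  by rewrite expr0n/= addr0 sqrtr0 expr0n.
move=> c f g /L2predP[[fr fi] f2] /L2predP[[gr gi] g2]; apply/L2predP.
have mh : cmeasurable (c *: f + g).
  split.
  - rewrite (_ : (fun _ => _) = (fun x =>
      (Re c * Re (f x) - Im c * Im (f x)) + Re (g x))); last first.
      by apply/funext => x; rewrite !fctE; case: (c) (f x) (g x) => a b [p q] [r s].
    by apply: measurable_funD => //; apply: measurable_funB => //;
      apply: measurable_funM => //; exact: measurable_cst.
  - rewrite (_ : (fun _ => _) = (fun x =>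
      (Re c * Im (f x) + Im c * Re (f x)) + Im (g x))); last first.
      by apply/funext => x; rewrite !fctE; case: (c) (f x) (g x) => a b [p q] [r s].
    by apply: measurable_funD => //; apply: measurable_funD => //;
      apply: measurable_funM => //; exact: measurable_cst.
split=> //.
have mf := @cmeasurable_sqr f (conj fr fi).
have mg := @cmeasurable_sqr g (conj gr gi).
have le x : ((normc ((c *: f + g) x) ^+ 2)%:E <=
    (2 * normc c ^+ 2)%:E * (normc (f x) ^+ 2)%:E +
     2%:E * (normc (g x) ^+ 2)%:E)%E.
  rewrite -!EFinM -EFinD lee_fin !normc2 !fctE.
  case: (c) (f x) (g x) => a b [p q] [r s] /=.
  rewrite -subr_ge0 (_ : _ - _ = (a * p - b * q - r) ^+ 2 + (a * q + b * p - s) ^+ 2).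
    by rewrite addr_ge0 ?sqr_ge0.
  by ring.
have c2 : 0 <= 2 * normc c ^+ 2 by rewrite mulr_ge0// sqr_ge0.
have ge0 (F : T -> C) (a : R) x : 0 <= a ->
  (0 <= a%:E * (normc (F x) ^+ 2)%:E)%E by move=> a0; rewrite mule_ge0// lee_fin sqr_ge0.
have mM (F : T -> C) (a : R) : cmeasurable F ->
    measurable_fun setT (fun x => a%:E * (normc (F x) ^+ 2)%:E)%E.
  by move=> /cmeasurable_sqr mF; apply: emeasurable_funM => //; exact: measurable_cst.
apply: (@le_lt_trans _ _ (\int[mu]_x ((2 * normc c ^+ 2)%:E * (normc (f x) ^+ 2)%:E +
     2%:E * (normc (g x) ^+ 2)%:E))%E).
  apply: ge0_le_integral => //.
  - by move=> x _; rewrite lee_fin sqr_ge0.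
  - exact: cmeasurable_sqr.
  - by apply: emeasurable_funD; exact: mM.
rewrite ge0_integralD//; [|by move=> x _; exact: ge0|exact: mM|
  by move=> x _; exact: ge0|exact: mM].
rewrite !ge0_integralZl//; [|by move=> x _; rewrite lee_fin sqr_ge0..].
by rewrite lte_add_pinfty// lte_mul_pinfty// lee_fin.
Qed.

HB.instance Definition _ := GRing.isSubmodClosed.Build _ _ L2pred L2_submod_closed.

Record L2fun := MkL2fun { L2val :> T -> C; L2valP : L2val \in L2pred }.

HB.instance Definition _ := [isSub for L2val].
HB.instance Definition _ := [Choice of L2fun by <:].
HB.instance Definition _ := [SubChoice_isSubLmodule of L2fun by <:].

Definition L2null : {pred L2fun} :=
  [pred f : L2fun | `[< {ae mu, forall x, f x = 0} >] ].

Lemma L2null_submod_closed : submod_closed L2null.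
Proof.
split; first by apply/asboolP; exact: aeW.
move=> c f g /asboolP f0 /asboolP g0; apply/asboolP.
apply: filterS2 f0 g0 => x f0 g0.
by rewrite -[L2val _ x]/(c * f x + g x) f0 g0 mulr0 addr0.
Qed.

HB.instance Definition _ :=
  GRing.isSubmodClosed.Build _ _ L2null L2null_submod_closed.

Definition L2 := Quotient.quot L2null.

HB.instance Definition _ := GRing.Zmodule.on L2.
HB.instance Definition _ := EqQuotient.on L2.

Lemma L2_eqP (f g : L2fun) :
  {ae mu, forall x, f x = g x} <-> f = g %[mod L2].
Proof.
rewrite (rwP eqP) -Quotient.idealrBE; split.
  move=> fg; apply/asboolP; apply: filterS fg => x fg.
  by rewrite -[L2val _ x]/(f x - g x) fg subrr.
move=> /asboolP fg; apply: filterS fg => x.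
by rewrite -[L2val _ x]/(f x - g x) => /eqP; rewrite subr_eq0 => /eqP.
Qed.

Let piD (f g : L2fun) : \pi_L2 (f + g) = \pi_L2 f + \pi_L2 g.
Proof. exact: Quotient.pi_add. Qed.

Definition L2scale (c : C) (u : L2) : L2 := \pi_L2 (c *: repr u).

Lemma L2scale_pi c (f : L2fun) : L2scale c (\pi_L2 f) = \pi_L2 (c *: f).
Proof.
apply/eqP; rewrite -Quotient.idealrBE -scalerBr rpredZ//.
by rewrite Quotient.idealrBE reprK.
Qed.

Lemma L2scaleA a b u : L2scale a (L2scale b u) = L2scale (a * b) u.
Proof. by elim/quotW: u => f; rewrite (L2scale_pi b f) !L2scale_pi scalerA. Qed.

Lemma L2scale1 : left_id 1 L2scale.
Proof. by elim/quotW => f; rewrite L2scale_pi scale1r. Qed.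

Lemma L2scaleDr : right_distributive L2scale +%R.
Proof.
move=> c; elim/quotW => f; elim/quotW => g.
by rewrite -piD !L2scale_pi -piD scalerDr.
Qed.

Lemma L2scaleDl u : {morph L2scale^~ u : a b / a + b}.
Proof.
by elim/quotW: u => f a b /=; rewrite !L2scale_pi -piD scalerDl.
Qed.

HB.instance Definition _ :=
  GRing.Zmodule_isLmodule.Build C L2 L2scaleA L2scale1 L2scaleDr L2scaleDl.

(* Linear in the first argument; independent of the representatives. *)
Definition L2dot (u v : L2) : C :=
  let p x := repr u x * conjc (repr v x) in
  Complex (\int[mu]_x Re (p x)) (\int[mu]_x Im (p x)).

End L2.

Arguments L2dot {d T R} mu u v.

(* A partially defined linear operator is given by its graph. *)

Section operators.
Context (R : realType) (H : lmodType R[i]) (dot : H -> H -> R[i]).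
Implicit Types (A : set (H * H)) (S : set H).

Definition is_operator A :=
  [/\ A (0, 0),
      forall (c : R[i]) p q, A p -> A q -> A (c *: p + q) &
      forall u v w, A (u, v) -> A (u, w) -> v = w].

Definition dom A : set H := [set u | exists v, A (u, v)].

Definition restriction A S : set (H * H) := [set p | A p /\ S p.1].

Definition dense_in S := forall (u : H) (e : R), 0 < e ->
  exists2 v, S v & Num.sqrt (Re (dot (u - v) (u - v))) < e.

(* The graph of the adjoint operator, when [A] is densely defined. *)
Definition adjoint A : set (H * H) :=
  [set p | forall q, A q -> dot q.2 p.1 = dot q.1 p.2].

Definition self_adjoint A :=
  [/\ is_operator A, dense_in (dom A) & adjoint A = A].

End operators.

Section functions.
Context (R : realType).
Local Notation C := R[i].
Implicit Types (f : R -> C) (x a : R).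

Definition is_cderive f x (l : C) :=
  is_derive x 1 (fun t => Re (f t)) (Re l) /\
  is_derive x 1 (fun t => Im (f t)) (Im l).

Definition csmooth f := forall (k : nat) x,
  derivable (derive1n k (fun t => Re (f t))) x 1 /\
  derivable (derive1n k (fun t => Im (f t))) x 1.

(* Elements of C_c^oo(O), extended by 0 to the whole line *)
Definition test_function (O : set R) f :=
  let supp := closure [set x | f x != 0] in
  [/\ csmooth f, compact supp & supp `<=` O].

Definition abs_cont (I : set R) f := forall eps : R, 0 < eps ->
  exists2 delta : R, 0 < delta &
    forall (m : nat) (a b : 'I_m -> R),
      (forall k, a k <= b k /\ `[a k, b k]%classic `<=` I) ->
      trivIset setT (fun k => `]a k, b k[%classic) ->
      \sum_k (b k - a k) < delta ->
      \sum_k normc (f (b k) - f (a k)) < eps.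

Definition lim_right f a : C :=
  Complex (lim (Re (f x) @[x --> a^'+])) (lim (Im (f x) @[x --> a^'+])).

Definition lim_left f a : C :=
  Complex (lim (Re (f x) @[x --> a^'-])) (lim (Im (f x) @[x --> a^'-])).

End functions.

Section momentum.
Context (R : realType) (n : nat) (alpha beta : 'I_n -> R).
Local Notation C := R[i].

Definition Omega : set R := \bigcup_(i in [set: 'I_n]) `]alpha i, beta i[%classic.

Lemma measurable_Omega : measurable (Omega : set (measurableTypeR R)).
Proof. by apply: fin_bigcup_measurable => // i _; exact: measurable_itv. Qed.

(* Elements of L^2(Omega) are represented by functions on the whole line,
   whose values outside Omega are irrelevant. *)
Definition mu_Omega : {measure set (measurableTypeR R) -> \bar R} :=
  mrestr (@lebesgue_measure R) measurable_Omega.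

Local Notation L2Omega := (L2 mu_Omega).

(* 1 / (2 pi i) *)
Definition inv_2ipi : C := (Complex 0 (2 * pi))^-1.

Definition D_op : set (L2Omega * L2Omega) :=
  [set p | exists f g : L2fun mu_Omega,
    [/\ test_function Omega f, forall x, is_cderive f x (g x) &
        p = (\pi_L2Omega f, inv_2ipi *: \pi_L2Omega g)]].

Definition D_star : set (L2Omega * L2Omega) := adjoint (L2dot mu_Omega) D_op.

(* For absolutely continuous f the derivative exists only a.e., so f' in L^2
   means that some square-integrable g is a.e. the derivative of f. *)
Definition D_max : set (L2fun mu_Omega) :=
  [set f | (forall i, abs_cont `]alpha i, beta i[%classic f) /\
    exists g : L2fun mu_Omega, {ae mu_Omega, forall x, is_cderive f x (g x)}].

Definition val_alpha (f : R -> C) : 'cV[C]_n := \col_i lim_right f (alpha i).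
Definition val_beta (f : R -> C) : 'cV[C]_n := \col_i lim_left f (beta i).

(* B f(alpha) = f(beta) is tested on the absolutely continuous representative. *)
Definition D_B (B : 'M[C]_n) : set L2Omega :=
  [set u | exists f : L2fun mu_Omega,
    [/\ D_max f, B *m val_alpha f = val_beta f & u = \pi_L2Omega f]].

End momentum.

Arguments mu_Omega {R n} alpha beta.
Arguments D_op {R n} alpha beta _.
Arguments D_star {R n} alpha beta _.
Arguments D_max {R n} alpha beta _.
Arguments D_B {R n} alpha beta B _.

(* Main.v *)
(* Integration by parts gives, for f and h in D_max,
     <D* f, h> - <f, D* h> = (1 / 2 pi i) (<f(beta), h(beta)> - <f(alpha), h(alpha)>),
   and the pair (f(alpha), f(beta)) ranges over all of C^n x C^n.  A self-adjoint
   extension A of D is a restriction of D*, and A = A* means that dom A consists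
   of the f in D_max whose boundary pair lies in a subspace W of C^n x C^n equal
   to its own orthogonal for the form <b, b'> - <a, a'>.  Such a W is the graph
   of a unitary matrix, and conversely.

   The domain of D* is D_max by the du Bois-Reymond lemma, tested with the smooth
   functions 1 - (1 - bump)^m, which converge boundedly to the indicator of an
   interval.  Integration by parts for absolutely continuous functions reduces
   to showing that an absolutely continuous function with derivative 0 almost
   everywhere is constant, which follows from Cousin's lemma.  The domains are
   dense because a truncated function is a limit of its difference quotients
   (F(x + h) - F(x)) / h, F a primitive. *)

Require Import Defs.
From mathcomp Require Import all_boot all_order all_algebra spectral.
From mathcomp Require Import all_classical all_reals all_analysis complex.
From mathcomp Require Import measurable_realfun ring lra.

Set Implicit Arguments.
Unset Strict Implicit.
Unset Printing Implicit Defensive.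

Import Order.TTheory GRing.Theory Num.Theory numFieldNormedType.Exports.

Local Open Scope classical_set_scope.
Local Open Scope ring_scope.

(** * Absolutely continuous functions *)

(** All the analysis is done for real functions. The derivatives, limits and integrals of complex
    functions are componentwise, and four real integrations by parts assemble into the complex one.
    Elements of L^2 are classes with an arbitrary representative, so derivatives and boundary values
    make sense on classes only once two absolutely continuous representatives are shown to agree on
    Omega. The number 1 / (2 pi i) is the opposite of its conjugate; this sign turns the sum
    produced by integration by parts into a difference. Since [adjoint] is a relation on graphs, the
    inclusion of [A] in [D_star] follows from the reversal of inclusions under adjoints. Density has
    to be shown for the domains [D_B]. There Lipschitz functions vanishing near the endpoints
    suffice, because zero boundary values satisfy the condition B f(alpha) = f(beta) for every B;
    difference quotients of primitives are such functions, and no smoothing is involved. *)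

Section cousin.
Context {R : realType}.

(** Let [s] be the supremum of the points [x] with [P a x]. The local hypothesis at [s] glues a
    nearby such [x] to any [v] at or slightly past [s], so [s] is reached and, unless [b] is already
    within range, surpassed. *)
Lemma cousin (P : R -> R -> Prop) (a b : R) : a <= b ->
  (forall x, a <= x <= b -> exists2 d, 0 < d &
    forall u v, a <= u -> v <= b -> u <= x <= v -> x - d < u -> v < x + d ->
    P u v) ->
  (forall u v w, P u v -> P v w -> P u w) ->
  P a b.
Proof.
move=> ab loc cat.
pose S := [set x | a <= x <= b /\ P a x].
have Sa : S a.
  split; first by rewrite lexx.
  have [|d d0 h] := loc a; first by rewrite lexx.
  by apply: h; rewrite ?lexx ?ltrBlDr ?ltrDl.
have ubS : ubound S b by move=> x [/andP[_ ?] _].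
have hS : has_sup S by split; [exists a|exists b].
set s := sup S.
have as_ : a <= s by apply: ub_le_sup => //; exists b.
have sb : s <= b by apply: ge_sup => //; exists a.
have [|d d0 h] := loc s; first by rewrite as_.
have [x Sx sx] := sup_adherent d0 hS.
have xs : x <= s by apply: ub_le_sup => //; exists b.
case: Sx => /andP[ax xb] Pax.
have Pav v : s <= v -> v <= b -> v < s + d -> P a v.
  move=> sv vb vd; apply: (cat _ x) => //.
  by apply: h => //; rewrite ?xs.
have [bs|bs] := ltP b (s + d); first exact: Pav.
have : S (s + d / 2).
  have dd : d / 2 < d by rewrite gtr_pMr// invf_lt1// ltr1n.
  have d20 : 0 < d / 2 by rewrite divr_gt0.
  split; last apply: Pav; rewrite ?lerDl ?ltW// ?ltrD2l//.
  - by rewrite (lt_le_trans _ bs) ?ltrD2l.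
  - by rewrite (le_lt_trans as_)// ltrDl.
  - by rewrite (lt_le_trans _ bs) ?ltrD2l.
move=> /(@ub_le_sup _ S) => /(_ (ex_intro _ b ubS)).
by rewrite -/s gerDl leNgt divr_gt0.
Qed.

End cousin.

Section absolutely_continuous.
Context {R : realType}.
Notation mu := (@lebesgue_measure R).
Implicit Types (F G g : R -> R) (I : set R).

(** Real counterpart of [abs_cont]; [abs_contE] passes between the two through real and imaginary
    parts. *)
Definition racont I F := forall eps : R, 0 < eps ->
  exists2 delta : R, 0 < delta &
    forall (m : nat) (a b : 'I_m -> R),
      (forall k, a k <= b k /\ `[a k, b k]%classic `<=` I) ->
      trivIset setT (fun k => `]a k, b k[%classic) ->
      \sum_k (b k - a k) < delta ->
      \sum_k `|F (b k) - F (a k)| < eps.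

Lemma racontS I J F : I `<=` J -> racont J F -> racont I F.
Proof.
move=> IJ acF e e0; have [d d0 h] := acF _ e0; exists d => // m a b abI.
by apply: h => k; have [? sub] := abI k; split => //; exact: subset_trans IJ.
Qed.

Lemma racont_comb I (c : R) F G : racont I F -> racont I G ->
  racont I (fun x => F x + c * G x).
Proof.
move=> acF acG e e0.
have e20 : 0 < e / 2 by rewrite divr_gt0.
have c0 : 0 < 1 + `|c| by rewrite ltr_wpDr.
have [d1 d10 h1] := acF _ e20.
have [d2 d20 h2] := acG (e / 2 / (1 + `|c|)) (divr_gt0 e20 c0).
exists (Num.min d1 d2); first by rewrite lt_min d10.
move=> m a b abI tr; rewrite lt_min => /andP[/(h1 m a b abI tr) {}h1].
move=> /(h2 m a b abI tr) {}h2.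
apply: (@le_lt_trans _ _ (\sum_k `|F (b k) - F (a k)| +
   (1 + `|c|) * \sum_k `|G (b k) - G (a k)|)).
  rewrite mulr_sumr -big_split/=; apply: ler_sum => k _.
  rewrite (_ : _ - _ = F (b k) - F (a k) + c * (G (b k) - G (a k))); last by ring.
  rewrite (le_trans (ler_normD _ _))// lerD2l normrM ler_wpM2r//.
  by rewrite lerDr.
rewrite [ltRHS](splitr e) ltrD//.
by rewrite mulrC -ltr_pdivlMr.
Qed.

Lemma lipschitz_racont I F (M : R) :
  (forall x y, I x -> I y -> `|F x - F y| <= M * `|x - y|) -> racont I F.
Proof.
move=> lip e e0; have M0 : 0 < 1 + `|M| by rewrite ltr_wpDr.
exists (e / (1 + `|M|)); first by rewrite divr_gt0.
move=> m a b abI tr; rewrite ltr_pdivlMr// mulrC; apply: le_lt_trans.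
rewrite mulr_sumr; apply: ler_sum => k _; have [ab sub] := abI k.
rewrite (le_trans (lip _ _ _ _))//.
- by apply: sub; rewrite /= in_itv/= lexx ab.
- by apply: sub; rewrite /= in_itv/= lexx ab.
- rewrite (ger0_norm (_ : 0 <= b k - a k)) ?subr_ge0// ler_wpM2r ?subr_ge0//.
  by rewrite (le_trans (ler_norm _))// lerDr.
Qed.

(** The variation of each factor is weighted by a bound on the other. On an interval these bounds
    are supplied by [racont_ends]. *)
Lemma racontM I F G (K L : R) :
  (forall x, I x -> `|F x| <= K) -> (forall x, I x -> `|G x| <= L) ->
  racont I F -> racont I G -> racont I (fun x => F x * G x).
Proof.
move=> FK GL acF acG e e0.
have e20 : 0 < e / 2 by rewrite divr_gt0.
have K0 : 0 < 1 + `|K| by rewrite ltr_wpDr.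
have L0 : 0 < 1 + `|L| by rewrite ltr_wpDr.
have [d1 d10 h1] := acF _ (divr_gt0 e20 L0).
have [d2 d20 h2] := acG _ (divr_gt0 e20 K0).
exists (Num.min d1 d2); first by rewrite lt_min d10.
move=> m a b abI tr; rewrite lt_min => /andP[/(h1 m a b abI tr) {}h1].
move=> /(h2 m a b abI tr) {}h2.
apply: (@le_lt_trans _ _ ((1 + `|L|) * \sum_k `|F (b k) - F (a k)| +
   (1 + `|K|) * \sum_k `|G (b k) - G (a k)|)).
  rewrite !mulr_sumr -big_split/=; apply: ler_sum => k _.
  have [ab sub] := abI k.
  have Ia : I (a k) by apply: sub; rewrite /= in_itv/= lexx ab.
  have Ib : I (b k) by apply: sub; rewrite /= in_itv/= lexx ab.
  rewrite (_ : _ - _ = G (b k) * (F (b k) - F (a k)) + F (a k) * (G (b k) - G (a k))); last by ring.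
  rewrite (le_trans (ler_normD _ _))// !normrM lerD// ler_wpM2r//.
    by rewrite (le_trans (GL _ _))// (le_trans (ler_norm _))// lerDr.
  by rewrite (le_trans (FK _ _))// (le_trans (ler_norm _))// lerDr.
by rewrite [ltRHS](splitr e) ltrD// mulrC -ltr_pdivlMr.
Qed.

(** An ordered list of intervals between [u] and [v], with gaps allowed: in [racont_derive0] it
    keeps only those intervals of a tagged partition whose tag lies in the exceptional null set. *)
Fixpoint chain (u : R) (s : seq (R * R)) (v : R) : Prop :=
  if s is p :: t then [/\ u <= p.1, p.1 <= p.2 & chain p.2 t v] else u <= v.

Lemma chain_le u s v : chain u s v -> u <= v.
Proof.
elim: s u => //= -[x y] s IH u /= [ux xy /IH].
by apply: le_trans; exact: le_trans ux xy.
Qed.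

Lemma chain_lel u u' s v : u' <= u -> chain u s v -> chain u' s v.
Proof.
case: s => [|p s] /= uu'; first exact: le_trans.
by move=> [up ? ?]; split => //; exact: le_trans up.
Qed.

Lemma chain_cat u s v t w : chain u s v -> chain v t w -> chain u (s ++ t) w.
Proof.
elim: s u => [|p s IH] u /=; first by move=> uv; exact: chain_lel.
by move=> [? ? ps] vt; split => //; exact: IH.
Qed.

Lemma chain_nth u s v i : chain u s v -> (i < size s)%N ->
  u <= (nth 0 s i).1 /\ (nth 0 s i).1 <= (nth 0 s i).2.
Proof.
elim: s u i => //= p s IH u [|i] [up pp ps] //= ilt.
have [? ?] := IH _ i ps ilt; split => //.
by rewrite (le_trans up)// (le_trans pp).
Qed.

Lemma chain_nth_lt u s v i j : chain u s v -> (i < j < size s)%N ->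
  (nth 0 s i).2 <= (nth 0 s j).1.
Proof.
elim: s u i j => [|p s IH] u i j /=; first by rewrite ltn0 andbF.
case: j => [|j]; first by rewrite ltn0.
move=> [up pp ps]; case: i => [|i] /=; last exact: IH ps.
by rewrite ltnS => /(chain_nth ps)[].
Qed.

Lemma chain_trivIset u s v : chain u s v ->
  trivIset setT (fun k : 'I_(size s) => `](nth 0 s k).1, (nth 0 s k).2[%classic).
Proof.
move=> ch; apply/trivIsetP => i j _ _.
wlog ij : i j / (i < j)%N.
  move=> h; rewrite neq_ltn => /orP[] ij; first by apply: h => //; rewrite neq_ltn ij.
  by rewrite setIC; apply: h => //; rewrite neq_ltn ij.
move=> _; rewrite -subset0 => x []; rewrite /= !in_itv/= => /andP[_ h1] /andP[h2 _].
have := @chain_nth_lt _ _ _ i j ch; rewrite ij ltn_ord => /(_ isT).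
by move=> /(lt_le_trans h1) /lt_trans/(_ h2); rewrite ltxx.
Qed.

(** Half-open intervals stay disjoint when consecutive ones share an endpoint, so the first one can
    be split off by additivity and the rest handled inside ]p.2, v]. *)
Lemma chain_measure (U : set R) u s v : measurable U -> chain u s v ->
  all (fun p => `[< `]p.1, p.2] `<=` U >]) s ->
  ((\sum_(p <- s) (p.2 - p.1))%:E <= mu (U `&` `]u, v]%classic))%E.
Proof.
move=> mU; elim: s u => [|p s IH] u /=; first by rewrite big_nil.
move=> [up pp ps] /andP[/asboolP pU sU]; rewrite big_cons EFinD.
have pv := chain_le ps.
apply: (@le_trans _ _ (mu `]p.1, p.2]%classic + mu (U `&` `]p.2, v]))%E).
  rewrite leeD ?IH//.
  rewrite lebesgue_measure_itv /= lte_fin.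
  by move: pp; rewrite le_eqVlt => /predU1P[->|->]; rewrite ?ltxx ?subrr ?EFinB.
rewrite -measureU; [|exact: measurable_itv|by apply: measurableI|]; last first.
  rewrite -subset0 => x [] /=; rewrite in_itv/= => /andP[_ h1] [_].
  by rewrite in_itv/= => /andP[+ _]; rewrite ltNge h1.
apply: le_measure; rewrite ?inE//.
- by apply: measurableU => //; exact: measurableI.
- exact: measurableI.
- move=> x [/[dup] /pU ? | [? +]] /=; rewrite !in_itv/= => /andP[h1 h2]; split => //.
    by rewrite (le_lt_trans up h1) (le_trans h2 pv).
  by rewrite (le_lt_trans (le_trans up pp) h1).
Qed.

(* Cover the null set where the derivative may fail to vanish by an open set of
   small measure: absolute continuity controls the intervals of a tagged
   partition with tags in that set, and the other tags contribute at most
   [e * (b - a)]. *)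
Lemma racont_derive0 (a b : R) F :
  racont `]a, b[%classic F ->
  {ae mu, forall x : R, x \in `]a, b[ -> is_derive x 1 F 0} ->
  {in `]a, b[ &, forall x y, F x = F y}.
Proof.
move=> acF [N [mN N0 sN]].
suff H : forall x y, x \in `]a, b[ -> y \in `]a, b[ -> x <= y -> F y = F x.
  by move=> x y xi yi; have [xy|/ltW xy] := leP x y; [rewrite -(H x y)|rewrite -(H y x)].
move=> x y xi yi xy.
suff H : forall e, 0 < e -> `|F y - F x| <= e * (y - x) + e.
  apply/eqP; rewrite -subr_eq0 -normr_eq0 eq_le normr_ge0 andbT.
  have c0 : 0 < (y - x) + 1 by rewrite ltr_wpDl// subr_ge0.
  apply/ler_addgt0Pl => e e0; rewrite addr0.
  (* This argument makes the bound of [H] equal to [e]. *)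
  rewrite (le_trans (H (e / ((y - x) + 1)) _)) ?divr_gt0//.
  rewrite -[X in _ + X]mulr1 -mulrDr divfK//.
  by rewrite gt_eqF.
move=> e e0; have [d d0 acd] := acF _ e0.
have [|U [oU NU mUd]] := @lebesgue_regularity_outer _ N d mN _ d0.
  by rewrite [ltLHS]N0.
have mU : measurable U by exact: open_measurable.
(* Outer regularity only bounds the measure of [U] minus [N]; adding the null set [N] changes
   nothing. *)
have {}mUd : (mu U < d%:E)%E.
  have UE : U = N `|` (U `\` N) by rewrite setDUK.
  rewrite UE (le_lt_trans (measureU2 _ _ _))//; first exact: measurableD.
  by rewrite [X in (X + _)%E]N0 add0e.
pose P u v := exists s, [/\ chain u s v,
  all (fun p => `[< `]p.1, p.2]%classic `<=` U >]) s &
  `|F v - F u| <= e * (v - u) + \sum_(p <- s) `|F p.2 - F p.1|].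
have : P x y.
  apply: cousin => //; last first.
    move=> u v w [s [us sU Fs]] [t [vt tU Ft]]; exists (s ++ t); split.
    - exact: chain_cat vt.
    - by rewrite all_cat sU.
    - rewrite big_cat/= (_ : F w - F u = (F v - F u) + (F w - F v)); last by ring.
      rewrite (le_trans (ler_normD _ _))// (le_trans (lerD Fs Ft))//.
      by rewrite addrACA -mulrDr (_ : v - u + (w - v) = w - u)//; ring.
  move=> t /andP[xt ty].
  have tab : t \in `]a, b[.
    move: xi yi; rewrite !in_itv/= => /andP[ax _] /andP[_ yb].
    by rewrite (lt_le_trans ax)//= (le_lt_trans ty).
  have [tN|tN] := pselect (N t).
    have /oU := NU _ tN; rewrite -nbhs_ballE => -[r /= r0 rU].
    exists r => // u v _ _ /andP[ut tv] ru vr; exists [:: (u, v)]; split => /=.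
    - by rewrite lexx (le_trans ut).
    - rewrite andbT; apply/asboolP => z; rewrite /= in_itv/= => /andP[uz zv].
      apply: rU; rewrite /ball/= ltr_norml; apply/andP; split.
        by rewrite ltrBrDl; lra.
      by lra.
    - rewrite big_seq1/= lerDr mulr_ge0 ?(ltW e0)// subr_ge0.
      exact: le_trans ut tv.
  have dFt : is_derive t 1 F 0.
    by apply: contrapT => h; apply: tN; apply: sN => /= /(_ tab).
  have [r r0 hr] : exists2 r, 0 < r & forall h, `|h| < r ->
      `|F (t + h) - F t| <= e * `|h|.
    have [/cvg_ex[l Hl] dF0] := dFt.
    have El : l = 0.
      have <- : 'D_1 F t = l by apply/cvg_lim => //.
      exact: dF0.
    move: Hl; rewrite El => /cvgrPdist_le /(_ e e0).
    move=> [r /= r0 hr]; exists r => // h hlt.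
    have [->|h0] := eqVneq h 0; first by rewrite addr0 subrr !normr0 mulr0.
    have := hr h; rewrite /ball/= sub0r normrN => /(_ hlt h0).
    rewrite sub0r normrN /GRing.scale/= mulr1 normrM normfV.
    rewrite mulrC ler_pdivrMr ?normr_gt0//.
    by rewrite (addrC t).
  exists r => // u v _ _ /andP[ut tv] ru vr; exists [::]; split => //=.
    exact: le_trans ut tv.
  rewrite big_nil addr0.
  have h1 := hr (v - t); have h2 := hr (u - t).
  rewrite (_ : F v - F u = (F v - F t) - (F u - F t)); last by ring.
  rewrite (le_trans (ler_normB _ _))//.
  have {}h1 : `|F v - F t| <= e * (v - t).
    rewrite -[X in _ * X]ger0_norm ?subr_ge0//.
    have := h1; rewrite (_ : t + (v - t) = v); last by ring.
    by apply; rewrite ger0_norm ?subr_ge0//; lra.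
  have {}h2 : `|F u - F t| <= e * (t - u).
    rewrite -[X in _ * X]ger0_norm ?subr_ge0// distrC.
    rewrite (_ : t + (u - t) = u) in h2; last by ring.
    rewrite distrC (distrC t); apply: h2.
    by rewrite distrC ger0_norm ?subr_ge0//; lra.
  rewrite (le_trans (lerD h1 h2))// -mulrDr.
  by rewrite (_ : v - t + (t - u) = v - u)//; ring.
move=> [s [ch sU /le_trans]]; apply; rewrite lerD2l ltW//.
rewrite (big_nth 0) big_mkord.
apply: (acd _ (fun k : 'I_(size s) => (nth 0 s k).1) (fun k => (nth 0 s k).2)).
- move=> k.
  have [xs1 s12] := chain_nth ch (ltn_ord k); split => //.
  have sy : (nth 0 s k).2 <= y.
    have : forall u t v i, chain u t v -> (i < size t)%N -> (nth 0 t i).2 <= v.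
      move=> u t v i; elim: t u i => //= p t IH u [|i] [_ _ pt] //= it.
        exact: chain_le pt.
      exact: IH pt _.
    by apply; first exact: ch.
  move=> z; rewrite /= !in_itv/= => /andP[z1 z2].
  move: xi yi; rewrite !in_itv/= => /andP[ax _] /andP[_ yb].
  by rewrite (lt_le_trans ax) ?(le_trans xs1)//= (le_lt_trans z2)// (le_lt_trans sy).
- exact: chain_trivIset ch.
- have <- : \sum_(p <- s) (p.2 - p.1) =
      \sum_(k < size s) ((nth 0 s k).2 - (nth 0 s k).1).
    by rewrite (big_nth 0) big_mkord.
  rewrite -lte_fin; apply: le_lt_trans mUd.
  apply: le_trans (chain_measure mU ch sU) _.
  by apply: le_measure; rewrite ?inE//; exact: measurableI.
Qed.

End absolutely_continuous.

Lemma aeS d (T : measurableType d) (R : realType) (mu : {measure set T -> \bar R})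
    (P Q : T -> Prop) : (forall x, P x -> Q x) ->
  {ae mu, forall x, P x} -> {ae mu, forall x, Q x}.
Proof. exact: filterS. Qed.

Lemma aeS2 d (T : measurableType d) (R : realType) (mu : {measure set T -> \bar R})
    (P Q S : T -> Prop) : (forall x, P x -> Q x -> S x) ->
  {ae mu, forall x, P x} -> {ae mu, forall x, Q x} -> {ae mu, forall x, S x}.
Proof. exact: filterS2. Qed.

(** * Primitives of integrable functions, boundary limits and integration by parts *)

Section primitive.
Context {R : realType}.
Notation mu := (@lebesgue_measure R).
Implicit Types (F G f g : R -> R).

Lemma Rintegral_bigsetU d (T : measurableType d) (nu : {measure set T -> \bar R})
    (I : choiceType) (s : seq I) (A : I -> set T) (f : T -> R) :
  (forall i, measurable (A i)) -> uniq s -> trivIset [set` s] A ->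
  nu.-integrable (\big[setU/set0]_(i <- s) A i) (EFin \o f) ->
  \int[nu]_(x in \big[setU/set0]_(i <- s) A i) f x =
  \sum_(i <- s) \int[nu]_(x in A i) f x.
Proof.
move=> mA; elim: s => [|i s IH]; first by rewrite !big_nil Rintegral_set0.
rewrite /= => /andP[ins us] tA; rewrite !big_cons => intf.
have ms : measurable (\big[setU/set0]_(j <- s) A j) by exact: bigsetU_measurable.
rewrite Rintegral_setU//; last first.
  apply/disj_set2P; rewrite -subset0 => x [Aix]; rewrite -bigcup_seq => -[j /= js Ajx].
  have ij : i = j.
    apply: (tA i j) => /=; rewrite ?inE ?eqxx// ?js ?orbT//.
    by exists x.
  by move: ins; rewrite ij js.
rewrite IH//.
- by apply: sub_trivIset tA => j /= js; rewrite inE js orbT.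
- by apply: integrableS intf => //; exact: measurableU.
Qed.

(** Integrating from [-oo] avoids a base point, so one primitive serves all intervals. For [g] cut
    off outside ]a, b[ it is 0 at [a] and the full integral at [b]. *)
Definition prim g x := \int[mu]_(t in `]-oo, x]) g t.

Section integrable_function.
Variable g : R -> R.
Hypothesis ig : mu.-integrable setT (EFin \o g).

Let igS (A : set R) : measurable A -> mu.-integrable A (EFin \o g).
Proof. by move=> mA; apply: integrableS ig. Qed.

Lemma primB x y : x <= y -> prim g y - prim g x = \int[mu]_(t in `]x, y]) g t.
Proof.
by move=> xy; rewrite /prim (@Rintegral_itvB R g -oo%O (BRight y) x)//; exact: igS.
Qed.

Lemma primB_le x y : x <= y ->
  `|prim g y - prim g x| <= \int[mu]_(t in `]x, y[) `|g t|.
Proof.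
move=> xy; rewrite primB// (le_trans (le_normr_Rintegral _ _))//; first exact: igS.
by rewrite Rintegral_itv_bndo_bndc//; apply: integrable_norm; exact: igS.
Qed.

(** The integral of |g| over a set of small measure is small, and the increments of the primitive
    are bounded by such integrals over disjoint intervals. *)
Lemma prim_racont : racont setT (prim g).
Proof.
move=> e e0; have [d [d0 h]] := integral_normr_continuous ig e0.
exists d => // m a b ab tr sd.
pose A (k : 'I_m) := `]a k, b k[%classic : set R.
have muA k : (mu (A k) <= (b k - a k)%:E)%E.
  rewrite /A lebesgue_measure_itv/= lte_fin; have [abk _] := ab k.
  by move: abk; rewrite le_eqVlt => /predU1P[->|->]; rewrite ?ltxx ?subrr ?EFinB.
have mA : measurable (\big[setU/set0]_(k < m) A k).
  by apply: bigsetU_measurable => k _; exact: measurable_itv.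
apply: (@le_lt_trans _ _ (\sum_(k < m) \int[mu]_(t in A k) `|g t|)).
  by apply: ler_sum => k _; apply: primB_le; case: (ab k).
have tA : trivIset [set` (index_enum 'I_m)] A by exact: sub_trivIset tr.
rewrite -Rintegral_bigsetU//.
- apply: h => //; rewrite measure_bigsetU_ord//.
  apply: le_lt_trans (_ : ((\sum_k (b k - a k))%:E < _)%E); last by rewrite lte_fin.
  by rewrite -sumEFin; apply: lee_sum => k _; exact: muA.
- by move=> k; exact: measurable_itv.
- by move=> k; exact: measurable_itv.
- exact: index_enum_uniq.
- by apply: integrable_norm; exact: igS.
Qed.

Lemma prim_derive : {ae mu, forall x : R, is_derive x 1 (prim g) (g x)}.
Proof.
have lg : locally_integrable setT g.
  rewrite (_ : g = g \_ setT); last by rewrite patch_setT.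
  exact: integrable_locally.
have := FTC1Ny (fun y => igS (measurable_itv `]-oo, y])) lg.
apply: aeS.
by move=> x [dx <-]; rewrite derive1E; exact: derivableP.
Qed.

Lemma prim_continuous : continuous (prim g).
Proof.
move=> x; apply/cvgrPdist_lt => e e0.
have [d d0 h] := prim_racont e0.
exists d => // y /= xy.
wlog xley : x y xy / x <= y.
  move=> H; have [xy'|/ltW yx'] := leP x y; first exact: H.
  by rewrite distrC; apply: H => //; rewrite distrC.
have := h 1%N (fun=> x) (fun=> y).
rewrite !big_ord1 distrC; apply => //.
- by apply/trivIsetP => i j _ _; rewrite !ord1 eqxx.
- by rewrite -(ger0_norm (_ : 0 <= y - x)) ?subr_ge0// distrC.
Qed.

Lemma prim_bounded x : `|prim g x| <= \int[mu]_t `|g t|.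
Proof.
rewrite (le_trans (le_normr_Rintegral _ _))//; first exact: igS.
rewrite /Rintegral fine_le//.
- by apply: integrable_fin_num => //; apply: integrable_norm; exact: igS.
- by apply: integrable_fin_num => //; apply: integrable_norm.
- apply: ge0_subset_integral => //=.
  by apply/measurable_EFinP; apply: measurableT_comp => //; apply/measurable_EFinP; case/integrableP : ig.
Qed.

End integrable_function.

Lemma integrable_patch (A : set R) g : measurable A ->
  mu.-integrable A (EFin \o g) -> mu.-integrable setT (EFin \o (g \_ A)).
Proof. by move=> mA; rewrite integrable_mkcond// restrict_EFin. Qed.

Lemma Rintegral_patch (A B : set R) g :
  \int[mu]_(x in A) (g \_ B) x = \int[mu]_(x in A `&` B) g x.
Proof. by rewrite Rintegral_mkcondr. Qed.

Section interval.
Variables (a b : R).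
Hypothesis ab : a < b.
Let I : set R := `]a, b[%classic.
Let mI : measurable I. Proof. exact: measurable_itv. Qed.

Lemma prim_left g : prim (g \_ I) a = 0.
Proof.
rewrite /prim Rintegral_patch (_ : _ `&` _ = set0) ?Rintegral_set0//.
rewrite -subset0 => x []; rewrite /I /= !in_itv/= => h /andP[+ _].
by rewrite ltNge h.
Qed.

Lemma prim_right g : prim (g \_ I) b = \int[mu]_(x in I) g x.
Proof.
rewrite /prim Rintegral_patch (_ : _ `&` _ = I)//.
by apply/setIidPr => x; rewrite /I /= !in_itv/= => /andP[_ /ltW].
Qed.

(** The difference of [F] and the primitive is absolutely continuous with derivative 0 almost
    everywhere, hence constant. *)
Lemma racont_prim F g : racont I F -> mu.-integrable I (EFin \o g) ->
  {ae mu, forall x : R, x \in `]a, b[ -> is_derive x 1 F (g x)} ->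
  exists k, {in `]a, b[, forall x, F x = k + prim (g \_ I) x}.
Proof.
move=> acF ig dF; have ig' := integrable_patch mI ig.
pose H x := F x + -1 * prim (g \_ I) x.
have acH : racont I H.
  by apply: racont_comb => //; exact: racontS (prim_racont ig').
have dH : {ae mu, forall x : R, x \in `]a, b[ -> is_derive x 1 H 0}.
  apply: aeS2 dF (prim_derive ig') => x dF dG xI.
  have {}dF := dF xI; rewrite patchE mem_set// in dG.
  rewrite /H (_ : (fun _ => _) = F - prim (g \_ I)); last first.
    by apply/funext => y; rewrite mulN1r.
  by apply: is_derive_eq; rewrite subrr.
have cH := racont_derive0 acH dH.
(* The constant is read off at the midpoint, which lies in the open interval. *)
exists (H ((a + b) / 2)) => x xI; rewrite -(cH x) ?midf_lt//.
  by rewrite /H mulN1r subrK.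
by rewrite in_itv/= !midf_lt.
Qed.

(** On the open interval [F] agrees with a constant plus a primitive, which is continuous and
    bounded on the whole line. Limits, continuity and the bound are read off from that extension. *)
Lemma racont_ends F g : racont I F -> mu.-integrable I (EFin \o g) ->
  {ae mu, forall x : R, x \in `]a, b[ -> is_derive x 1 F (g x)} ->
  [/\ cvg (F x @[x --> a^'+]), cvg (F x @[x --> b^'-]),
      \int[mu]_(x in I) g x = lim (F x @[x --> b^'-]) - lim (F x @[x --> a^'+]),
      {in I, continuous F} &
      exists K : R, forall x, I x -> `|F x| <= K].
Proof.
move=> acF ig dF; have ig' := integrable_patch mI ig.
have [k Fk] := racont_prim acF ig dF.
pose G x := k + prim (g \_ I) x.
have cG : continuous G.
  by move=> x; apply: cvgD; [exact: cvg_cst|exact: prim_continuous].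
have ca : F x @[x --> a^'+] --> k.
  have -> : k = G a by rewrite /G prim_left addr0.
  apply: cvg_trans (cvg_at_right_filter (cG a)); apply: near_eq_cvg.
  apply: filterS2 (nbhs_right_gt a) (nbhs_right_lt ab) => x ax xb.
  by rewrite Fk// in_itv/= ax.
have cb : F x @[x --> b^'-] --> k + \int[mu]_(x in I) g x.
  have -> : k + \int[mu]_(x in I) g x = G b by rewrite /G prim_right.
  apply: cvg_trans (cvg_at_left_filter (cG b)); apply: near_eq_cvg.
  apply: filterS2 (nbhs_left_gt ab) (nbhs_left_lt b) => x ax xb.
  by rewrite Fk// in_itv/= ax.
split.
- by apply/cvg_ex; exists k.
- by apply/cvg_ex; exists (k + \int[mu]_(x in I) g x).
- have -> : lim (F x @[x --> a^'+]) = k by exact/cvg_lim.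
  have -> : lim (F x @[x --> b^'-]) = k + \int[mu]_(x in I) g x by exact/cvg_lim.
  by rewrite addrC addKr.
- move=> x /set_mem xI; rewrite /continuous_at Fk//.
  apply: cvg_trans (cG x); apply: near_eq_cvg.
  have := @near_in_itvoo R a b x xI.
  by apply: filterS => y /Fk ->.
- exists (`|k| + \int[mu]_t `|(g \_ I) t|) => x /Fk ->.
  by rewrite (le_trans (ler_normD _ _))// lerD2l prim_bounded.
Qed.

(** Both factors are bounded by [racont_ends], so their product is absolutely continuous with an
    integrable derivative, and [racont_ends] applies to the product. *)
Lemma racont_by_parts F1 F2 g1 g2 : racont I F1 -> racont I F2 ->
  mu.-integrable I (EFin \o g1) -> mu.-integrable I (EFin \o g2) ->
  {ae mu, forall x : R, x \in `]a, b[ -> is_derive x 1 F1 (g1 x)} ->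
  {ae mu, forall x : R, x \in `]a, b[ -> is_derive x 1 F2 (g2 x)} ->
  \int[mu]_(x in I) (g1 x * F2 x) + \int[mu]_(x in I) (F1 x * g2 x) =
  lim (F1 x @[x --> b^'-]) * lim (F2 x @[x --> b^'-]) -
  lim (F1 x @[x --> a^'+]) * lim (F2 x @[x --> a^'+]).
Proof.
move=> ac1 ac2 i1 i2 d1 d2.
have [ca1 cb1 E1 cF1 [K1 FK1]] := racont_ends ac1 i1 d1.
have [ca2 cb2 E2 cF2 [K2 FK2]] := racont_ends ac2 i2 d2.
have mF F : {in I, continuous F} -> measurable_fun I F.
  by move=> cF; apply: open_continuous_measurable_fun.
have bd F (K : R) : (forall x, I x -> `|F x| <= K) -> [bounded F x | x in I].
  move=> FK; exists K; split; first exact: num_real.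
  by move=> M KM x Ix; apply: le_trans (FK _ Ix) _; exact: ltW.
have ig1 : mu.-integrable I (EFin \o (fun x => g1 x * F2 x)).
  rewrite (_ : _ \o _ = ((EFin \o g1) \* (EFin \o F2))%E).
    by apply: integrableMl => //; [exact: mF|exact: bd FK2].
  by apply/funext => x /=; rewrite EFinM.
have ig2 : mu.-integrable I (EFin \o (fun x => F1 x * g2 x)).
  rewrite (_ : _ \o _ = ((EFin \o F1) \* (EFin \o g2))%E).
    by apply: integrableMr => //; [exact: mF|exact: bd FK1].
  by apply/funext => x /=; rewrite EFinM.
rewrite -RintegralD//.
have acM : racont I (fun x => F1 x * F2 x) by exact: racontM FK1 FK2 ac1 ac2.
have [||_ _ -> _ _] := racont_ends (g := fun x => g1 x * F2 x + F1 x * g2 x) acM.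
- rewrite (_ : _ \o _ = ((EFin \o (fun x => g1 x * F2 x)%R) \+ (EFin \o (fun x => F1 x * g2 x)%R))%E).
    by apply: integrableD => //; exact: measurable_itv.
  by apply/funext => x /=; rewrite EFinD.
- apply: aeS2 d1 d2 => x d1 d2 xI; have {}d1 := d1 xI; have {}d2 := d2 xI.
  rewrite [X in is_derive _ _ _ X](_ : _ = F1 x * g2 x + F2 x * g1 x).
    exact: is_deriveM.
  by rewrite addrC (mulrC (g1 x)).
rewrite (cvg_lim (@Rhausdorff R) (cvgM cb1 cb2)).
by rewrite (cvg_lim (@Rhausdorff R) (cvgM ca1 ca2)).
Qed.

End interval.

End primitive.

(** * Square-integrable functions *)

Section L2_theory.
Context d (T : measurableType d) (R : realType).
Variable mu : {measure set T -> \bar R}.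
Local Notation C := R[i].
Local Notation Re := complex.Re.
Local Notation Im := complex.Im.
Implicit Types (f g : L2fun mu) (p q : T -> R).

Lemma normc_sqr (z : C) : Normc.normc z ^+ 2 = Re z ^+ 2 + Im z ^+ 2.
Proof. by case: z => a b; rewrite sqr_sqrtr// addr_ge0 ?sqr_ge0. Qed.

Lemma L2fun_Re_measurable f : measurable_fun setT (fun x => Re (f x)).
Proof. by have /asboolP[[]] := L2valP f. Qed.

Lemma L2fun_Im_measurable f : measurable_fun setT (fun x => Im (f x)).
Proof. by have /asboolP[[]] := L2valP f. Qed.

Lemma le_integrableR p q : measurable_fun setT p -> (forall x, `|p x| <= `|q x|) ->
  mu.-integrable setT (EFin \o q) -> mu.-integrable setT (EFin \o p).
Proof.
move=> mp pq; apply: le_integrable => //; first exact/measurable_EFinP.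
by move=> x _ /=; rewrite lee_fin.
Qed.

Lemma L2fun_normc_integrable f :
  mu.-integrable setT (EFin \o (fun x => Re (f x) ^+ 2 + Im (f x) ^+ 2)).
Proof.
apply/integrableP; split.
  apply/measurable_EFinP; apply: measurable_funD; apply: measurable_funX.
    exact: L2fun_Re_measurable.
  exact: L2fun_Im_measurable.
have /asboolP[_] := L2valP f; congr (_ < _)%E; apply: eq_integral => x _ /=.
by rewrite normc_sqr ger0_norm// addr_ge0 ?sqr_ge0.
Qed.

Lemma L2fun_Re_integrable f :
  mu.-integrable setT (EFin \o (fun x => Re (f x) ^+ 2)).
Proof.
apply: le_integrableR (L2fun_normc_integrable f).
  by apply: measurable_funX; exact: L2fun_Re_measurable.
by move=> x; rewrite !ger0_norm ?addr_ge0 ?sqr_ge0// lerDl sqr_ge0.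
Qed.

Lemma L2fun_Im_integrable f :
  mu.-integrable setT (EFin \o (fun x => Im (f x) ^+ 2)).
Proof.
apply: le_integrableR (L2fun_normc_integrable f).
  by apply: measurable_funX; exact: L2fun_Im_measurable.
by move=> x; rewrite !ger0_norm ?addr_ge0 ?sqr_ge0// lerDr sqr_ge0.
Qed.

Section domain.
Variables (D : set T) (mD : measurable D).

Lemma integrableDR p q : mu.-integrable D (EFin \o p) ->
  mu.-integrable D (EFin \o q) -> mu.-integrable D (EFin \o (fun x => p x + q x)).
Proof.
move=> ip iq; rewrite (_ : _ \o _ = (EFin \o p) \+ (EFin \o q))%E.
  exact: integrableD.
by apply/funext => x /=; rewrite EFinD.
Qed.

Lemma integrableZR (c : R) p : mu.-integrable D (EFin \o p) ->
  mu.-integrable D (EFin \o (fun x => c * p x)).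
Proof.
move=> ip; rewrite (_ : _ \o _ = (fun x => c%:E * (EFin \o p) x)%E).
  exact: integrableZl.
by apply/funext => x /=; rewrite EFinM.
Qed.

Lemma integrableBR p q : mu.-integrable D (EFin \o p) ->
  mu.-integrable D (EFin \o q) -> mu.-integrable D (EFin \o (fun x => p x - q x)).
Proof.
move=> ip iq; rewrite (_ : _ \o _ = (EFin \o (fun x => p x + (- 1) * q x))).
  by apply: integrableDR => //; exact: integrableZR.
by apply/funext => x /=; rewrite mulN1r.
Qed.

End domain.

Lemma sqr_integrableM p q : measurable_fun setT p -> measurable_fun setT q ->
  mu.-integrable setT (EFin \o (fun x => p x ^+ 2)) ->
  mu.-integrable setT (EFin \o (fun x => q x ^+ 2)) ->
  mu.-integrable setT (EFin \o (fun x => p x * q x)).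
Proof.
move=> mp mq ip iq; apply: le_integrableR (integrableDR measurableT ip iq).
  exact: measurable_funM.
move=> x; rewrite [leRHS]ger0_norm ?addr_ge0 ?sqr_ge0// normrM.
rewrite -(real_normK (num_real (p x))) -(real_normK (num_real (q x))).
have := sqr_ge0 (`|p x| - `|q x|); have := normr_ge0 (p x); have := normr_ge0 (q x).
nra.
Qed.

Lemma L2fun_of p q : measurable_fun setT p -> measurable_fun setT q ->
  mu.-integrable setT (EFin \o (fun x => p x ^+ 2)) ->
  mu.-integrable setT (EFin \o (fun x => q x ^+ 2)) ->
  {f : L2fun mu | L2val f = fun x => Complex (p x) (q x)}.
Proof.
move=> mp mq ip iq; have fL : (fun x => Complex (p x) (q x)) \in L2pred mu.
  apply/asboolP; split => //.
  have /integrableP[_] := integrableDR measurableT ip iq.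
  congr (_ < _)%E; apply: eq_integral => x _.
  by rewrite normc_sqr/= ger0_norm// addr_ge0 ?sqr_ge0.
by exists (MkL2fun fL).
Qed.

Local Notation pi f := (\pi_(L2 mu)%qT f : L2 mu).

Lemma ae_repr_pi f : {ae mu, forall x, repr (pi f) x = f x}.
Proof. by apply/L2_eqP; rewrite reprK. Qed.

Lemma eq_L2 f g : {ae mu, forall x, f x = g x} <-> pi f = pi g.
Proof. exact: L2_eqP. Qed.

Lemma ae_eq_Rintegral p q : measurable_fun setT p -> measurable_fun setT q ->
  {ae mu, forall x, p x = q x} -> \int[mu]_x p x = \int[mu]_x q x.
Proof.
move=> mp mq pq; congr fine; apply: ae_eq_integral => //.
- exact/measurable_EFinP.
- exact/measurable_EFinP.
- by apply: filterS pq => x /= ->.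
Qed.

Lemma Re_mul_conj (z w : C) : Re (z * conjc w) = Re z * Re w + Im z * Im w.
Proof. by case: z w => a b [c e] /=; rewrite mulrN opprK. Qed.

Lemma Im_mul_conj (z w : C) : Im (z * conjc w) = Im z * Re w - Re z * Im w.
Proof. by case: z w => a b [c e] /=; rewrite mulrN addrC. Qed.

Lemma measurable_Re_mul_conj f g :
  measurable_fun setT (fun x => Re (f x * conjc (g x))).
Proof.
under eq_fun do rewrite Re_mul_conj.
by apply: measurable_funD; apply: measurable_funM;
  do ?[exact: L2fun_Re_measurable | exact: L2fun_Im_measurable].
Qed.

Lemma measurable_Im_mul_conj f g :
  measurable_fun setT (fun x => Im (f x * conjc (g x))).
Proof.
under eq_fun do rewrite Im_mul_conj.
by apply: measurable_funB; apply: measurable_funM;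
  do ?[exact: L2fun_Re_measurable | exact: L2fun_Im_measurable].
Qed.

Lemma L2dot_pi f g : L2dot mu (pi f) (pi g) =
  Complex (\int[mu]_x Re (f x * conjc (g x))) (\int[mu]_x Im (f x * conjc (g x))).
Proof.
have fg := aeS2 (fun x (h1 : repr (pi f) x = f x) (h2 : repr (pi g) x = g x) =>
  conj h1 h2) (ae_repr_pi f) (ae_repr_pi g).
rewrite /L2dot; congr Complex; apply: ae_eq_Rintegral.
- exact: measurable_Re_mul_conj.
- exact: measurable_Re_mul_conj.
- by apply: aeS fg => x [-> ->].
- exact: measurable_Im_mul_conj.
- exact: measurable_Im_mul_conj.
- by apply: aeS fg => x [-> ->].
Qed.

Lemma integrable_Re_Re f g :
  mu.-integrable setT (EFin \o (fun x => Re (f x) * Re (g x))).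
Proof.
by apply: sqr_integrableM; do ?[exact: L2fun_Re_measurable | exact: L2fun_Re_integrable].
Qed.

Lemma integrable_Im_Im f g :
  mu.-integrable setT (EFin \o (fun x => Im (f x) * Im (g x))).
Proof.
by apply: sqr_integrableM; do ?[exact: L2fun_Im_measurable | exact: L2fun_Im_integrable].
Qed.

Lemma integrable_Im_Re f g :
  mu.-integrable setT (EFin \o (fun x => Im (f x) * Re (g x))).
Proof.
by apply: sqr_integrableM; do ?[exact: L2fun_Re_measurable | exact: L2fun_Re_integrable
  | exact: L2fun_Im_measurable | exact: L2fun_Im_integrable].
Qed.

Lemma integrable_Re_Im f g :
  mu.-integrable setT (EFin \o (fun x => Re (f x) * Im (g x))).
Proof.
by apply: sqr_integrableM; do ?[exact: L2fun_Re_measurable | exact: L2fun_Re_integrable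
  | exact: L2fun_Im_measurable | exact: L2fun_Im_integrable].
Qed.

(** Written as four integrals of real products, the form to which real integration by parts
    applies. *)
Lemma L2dotE f g : L2dot mu (pi f) (pi g) =
  Complex (\int[mu]_x (Re (f x) * Re (g x)) + \int[mu]_x (Im (f x) * Im (g x)))
          (\int[mu]_x (Im (f x) * Re (g x)) - \int[mu]_x (Re (f x) * Im (g x))).
Proof.
rewrite L2dot_pi; congr Complex.
- rewrite -RintegralD//; [|exact: integrable_Re_Re|exact: integrable_Im_Im].
  by under eq_Rintegral do rewrite Re_mul_conj.
- rewrite -RintegralB//; [|exact: integrable_Im_Re|exact: integrable_Re_Im].
  by under eq_Rintegral do rewrite Im_mul_conj.
Qed.

Lemma pi_lin (c : C) f g : pi (c *: f + g) = c *: pi f + pi g.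
Proof. by rewrite -[c *: pi f]/(L2scale c (pi f)) L2scale_pi; exact: Quotient.pi_add. Qed.

Lemma piZ (c : C) f : pi (c *: f) = c *: pi f.
Proof. by rewrite -[c *: pi f]/(L2scale c (pi f)) L2scale_pi. Qed.

Definition cintegral (h : T -> C) : C :=
  Complex (\int[mu]_x Re (h x)) (\int[mu]_x Im (h x)).

Lemma cintegralZ (c : C) (h : T -> C) :
  mu.-integrable setT (EFin \o (fun x => Re (h x))) ->
  mu.-integrable setT (EFin \o (fun x => Im (h x))) ->
  cintegral (fun x => c * h x) = c * cintegral h.
Proof.
case: c => a b iR iI; rewrite /cintegral.
have -> : (a +i* b)%C * (\int[mu]_x Re (h x) +i* \int[mu]_x Im (h x))%C =
  ((a * \int[mu]_x Re (h x) - b * \int[mu]_x Im (h x)) +i*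
   (a * \int[mu]_x Im (h x) + b * \int[mu]_x Re (h x)))%C by [].
rewrite -!RintegralZl// -RintegralB//; try exact: integrableZR.
rewrite -RintegralD//; try exact: integrableZR.
by congr Complex; apply: eq_Rintegral => x _; case: (h x).
Qed.

Lemma integrable_Re_mul_conj f g :
  mu.-integrable setT (EFin \o (fun x => Re (f x * conjc (g x)))).
Proof.
under eq_fun do rewrite Re_mul_conj.
by apply: integrableDR; [by []|exact: integrable_Re_Re|exact: integrable_Im_Im].
Qed.

Lemma integrable_Im_mul_conj f g :
  mu.-integrable setT (EFin \o (fun x => Im (f x * conjc (g x)))).
Proof.
under eq_fun do rewrite Im_mul_conj.
by apply: integrableBR; [by []|exact: integrable_Im_Re|exact: integrable_Re_Im].
Qed.

Lemma L2dotZl (c : C) (u v : L2 mu) : L2dot mu (c *: u) v = c * L2dot mu u v.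
Proof.
elim/quotW: u => f; elim/quotW: v => g; rewrite -piZ !L2dot_pi.
rewrite -[RHS]cintegralZ; [|exact: integrable_Re_mul_conj|exact: integrable_Im_mul_conj].
by congr Complex; apply: eq_Rintegral => x _; rewrite mulrA.
Qed.

Lemma L2dotZr (c : C) (u v : L2 mu) : L2dot mu u (c *: v) = conjc c * L2dot mu u v.
Proof.
elim/quotW: u => f; elim/quotW: v => g; rewrite -piZ !L2dot_pi.
rewrite -[RHS]cintegralZ; [|exact: integrable_Re_mul_conj|exact: integrable_Im_mul_conj].
by congr Complex; apply: eq_Rintegral => x _; rewrite mulrCA -rmorphM.
Qed.

End L2_theory.

(** * Integration with respect to a restricted measure *)

Section restricted_measure.
Context d (T : measurableType d) (R : realType).
Variables (mu : {measure set T -> \bar R}) (D : set T) (mD : measurable D).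
Local Notation nu := (mrestr mu mD).

Lemma integral_mrestr (f : T -> \bar R) : measurable_fun setT f ->
  (\int[nu]_x f x = \int[mu]_(x in D) f x)%E.
Proof.
move=> mf; rewrite -(setUv D) integral_setU//=.
- rewrite [X in (_ + X)%E](_ : _ = 0%E) ?adde0.
    apply: eq_measure_integral => A mA AD.
    by rewrite -[LHS]/(mu (A `&` D)); congr (mu _); apply/setIidl.
  apply: null_set_integral.
  + exact: measurableC.
  + exact: measurable_funTS.
  + by rewrite -[LHS]/(mu (~` D `&` D)) setICl measure0.
- exact: measurableC.
- by rewrite setUv.
- by apply/disj_set2P; rewrite setICr.
Qed.

Lemma Rintegral_mrestr (f : T -> R) : measurable_fun setT f ->
  \int[nu]_x f x = \int[mu]_(x in D) f x.
Proof. by move=> mf; rewrite /Rintegral integral_mrestr//; exact/measurable_EFinP. Qed.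

Lemma integrable_mrestr (f : T -> R) : measurable_fun setT f ->
  nu.-integrable setT (EFin \o f) <-> mu.-integrable D (EFin \o f).
Proof.
move=> mf; have mf' : measurable_fun setT (EFin \o f) by exact/measurable_EFinP.
split => /integrableP[_ h]; apply/integrableP; split => //.
- exact: measurable_funTS.
- by move: h; rewrite integral_mrestr//; exact: measurableT_comp.
- by rewrite integral_mrestr//; exact: measurableT_comp.
Qed.

Lemma ae_mrestr (P : T -> Prop) :
  {ae nu, forall x, P x} <-> {ae mu, forall x, D x -> P x}.
Proof.
split=> [[N [mN N0 sN]]|[N [mN N0 sN]]].
  exists (N `&` D); split => //; first exact: measurableI.
  by move=> x /= /not_implyP[Dx nP]; split => //; apply: sN.
exists (N `|` ~` D); split.
- by apply: measurableU => //; exact: measurableC.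
- rewrite -[LHS]/(mu ((N `|` ~` D) `&` D)) setIUl setICl setU0; apply/eqP; rewrite -measure_le0 -N0.
  by apply: le_measure; rewrite ?inE//; exact: measurableI.
- move=> x /= nP; have [Dx|] := pselect (D x); last by right.
  by left; apply: sN => /= /(_ Dx).
Qed.

End restricted_measure.

(** * Lebesgue measure on a finite union of separated intervals *)

Section union_of_intervals.
Context {R : realType} (n : nat) (alpha beta : 'I_n -> R).
Hypothesis alpha_lt_beta : forall i : 'I_n, alpha i < beta i.
Hypothesis beta_lt_alpha : forall i j : 'I_n, j = i.+1 :> nat -> beta i < alpha j.
Notation mu := (@lebesgue_measure R).
Local Notation Om := (Omega alpha beta).
Local Notation muO := (mu_Omega alpha beta).
Local Notation I i := (`]alpha i, beta i[%classic : set (measurableTypeR R)).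

(** The hypothesis compares neighbouring intervals only; induction on [j] crosses the intermediate
    intervals from left to right. *)
Lemma beta_le_alpha (i j : 'I_n) : (i < j)%N -> beta i < alpha j.
Proof.
move: i j => [i ilt] [j jlt] /= ij.
elim: j jlt ij => // j IH jlt; rewrite ltnS leq_eqVlt => /predU1P[ij|ij].
  by apply: beta_lt_alpha => /=; rewrite ij.
have jn : (j < n)%N by exact: ltn_trans jlt.
apply: lt_trans (IH jn ij) (lt_trans (alpha_lt_beta _) _).
by apply: beta_lt_alpha.
Qed.

(** The intervals are taken closed, so that an endpoint of one is also kept out of all the
    others. *)
Lemma interval_disjoint (i j : 'I_n) (x : R) :
  alpha i <= x <= beta i -> alpha j <= x <= beta j -> i = j.
Proof.
move=> /andP[ai ib] /andP[aj jb]; apply/val_inj => /=.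
case: (ltngtP i j) => // /beta_le_alpha.
  by rewrite ltNge (le_trans aj).
by rewrite ltNge (le_trans ai).
Qed.

Lemma OmegaE : Om = \big[setU/set0]_(i < n) I i.
Proof.
rewrite /Omega -bigcup_seq; apply/seteqP; split => x [i _ Ii]; exists i => //=.
by rewrite mem_index_enum.
Qed.

Lemma interval_trivIset : trivIset setT (fun i => I i).
Proof.
move=> i j _ _ [x [/= xi xj]]; apply: (@interval_disjoint _ _ x).
  by move: xi; rewrite in_itv/= => /andP[/ltW-> /ltW->].
by move: xj; rewrite in_itv/= => /andP[/ltW-> /ltW->].
Qed.

Lemma mu_Omega_fin : (muO setT < +oo)%E.
Proof.
have muI i : (mu (I i) < +oo)%E.
  rewrite lebesgue_measure_itv/=; case: ifP => // _.
  by rewrite -EFinB ltry.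
rewrite -[X in (X < _)%E]/(mu (setT `&` Om)) setTI OmegaE measure_bigsetU_ord.
- by apply/lte_sum_pinfty => i _; exact: muI.
- by move=> i; exact: measurable_itv.
- exact: interval_trivIset.
Qed.

Lemma muO_integrable (f : R -> R) (i : 'I_n) : measurable_fun (setT : set (measurableTypeR R)) f ->
  muO.-integrable setT (EFin \o f) -> mu.-integrable (I i) (EFin \o f).
Proof.
move=> mf /integrable_mrestr -/(_ mf); apply: integrableS.
- exact: measurable_Omega.
- exact: measurable_itv.
- by move=> x xi; exists i.
Qed.

Lemma Rintegral_muO (f : R -> R) : measurable_fun (setT : set (measurableTypeR R)) f ->
  muO.-integrable setT (EFin \o f) ->
  \int[muO]_x f x = \sum_(i < n) \int[mu]_(x in I i) f x.
Proof.
move=> mf fi; rewrite Rintegral_mrestr// OmegaE Rintegral_bigsetU//.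
- exact: index_enum_uniq.
- by apply: sub_trivIset interval_trivIset.
- by rewrite -OmegaE; apply: (integrable_mrestr _ (measurable_Omega alpha beta) mf).1.
Qed.

(** Omega has finite measure, so the constant 1 is square-integrable and [f] is a product of two
    square-integrable functions. *)
Lemma integrable_muO (f : R -> R) : measurable_fun (setT : set (measurableTypeR R)) f ->
  muO.-integrable setT (EFin \o (fun x => f x ^+ 2)) ->
  muO.-integrable setT (EFin \o f).
Proof.
move=> mf f2; rewrite (_ : f = (fun x => f x * cst 1 x)); last first.
  by apply/funext => x /=; rewrite mulr1.
apply: sqr_integrableM => //; apply: measurable_bounded_integrable => //.
  exact: mu_Omega_fin.
- by apply: measurable_funX; exact: measurable_cst.
- by exists 1; split => // M M1 x _ /=; rewrite expr1n normr1 ltW.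
Qed.

Lemma bounded_sqr_integrable (f : R -> R) (K : R) :
  measurable_fun (setT : set (measurableTypeR R)) f ->
  (forall x, `|f x| <= K) ->
  muO.-integrable setT (EFin \o (fun x => f x ^+ 2)).
Proof.
move=> mf fK; apply: measurable_bounded_integrable => //.
- exact: mu_Omega_fin.
- exact: measurable_funX.
- exists (K ^+ 2); split; first exact: num_real.
  move=> M KM x _ /=; rewrite normrX; apply: le_trans (ltW KM).
  by rewrite lerXn2r// ?nnegrE// (le_trans _ (fK x)).
Qed.

End union_of_intervals.

(** * Smooth plateau functions and the du Bois-Reymond lemma *)

Section smooth_functions.
Context {R : realType}.
Implicit Types (f g : R -> R) (p : {poly R}).

Definition rsmooth f := forall k (x : R), derivable (derive1n k f) x 1.

Lemma derive1_is_derive f (g : R -> R) : (forall x : R, is_derive x 1 f (g x)) -> f^`()%classic = g.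
Proof. by move=> fg; apply/funext => x; rewrite derive1E; have [] := fg x. Qed.

Lemma derivable_is_derive f (x : R) : derivable f x 1 -> is_derive x 1 f (f^`()%classic x).
Proof. by move=> df; rewrite derive1E; exact: derivableP. Qed.

(** Induction on [k] keeps the k-th derivative in [S]. Proving smoothness thus amounts to finding a
    class of differentiable functions stable under derivation. *)
Lemma rsmooth_coind (S : (R -> R) -> Prop) :
  (forall f, S f -> (forall x : R, derivable f x 1) /\ S f^`()%classic) ->
  forall f, S f -> rsmooth f.
Proof.
move=> SD f Sf k; apply: (SD _ _).1.
by elim: k => //= k IH; exact: (SD _ IH).2.
Qed.

Lemma rsmooth_derive f : rsmooth f -> rsmooth f^`()%classic.
Proof. by move=> sf k x; rewrite -derive1Sn; exact: sf. Qed.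

Lemma rsmooth_derivable f (x : R) : rsmooth f -> derivable f x 1.
Proof. by move=> /(_ 0%N). Qed.

Lemma rsmooth_primitive f g : (forall x : R, is_derive x 1 f (g x)) -> rsmooth g -> rsmooth f.
Proof.
move=> fg sg [|k] x; first by have [] := fg x.
by rewrite derive1Sn (derive1_is_derive fg); exact: sg.
Qed.

(** The derivative of a sum, a product or an affine substitution is again built by these
    constructors, so the class is stable under derivation and [rsmooth_coind] replaces any formula
    for k-th derivatives. *)
Inductive smooth_alg : (R -> R) -> Prop :=
| smooth_base f : rsmooth f -> smooth_alg f
| smooth_add f g : smooth_alg f -> smooth_alg g -> smooth_alg (fun x => f x + g x)
| smooth_mul f g : smooth_alg f -> smooth_alg g -> smooth_alg (fun x => f x * g x)
| smooth_affine f (c e : R) : smooth_alg f -> smooth_alg (fun x => f (c * x + e)).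

Lemma rsmooth_cst (c : R) : rsmooth (fun=> c).
Proof.
apply: (@rsmooth_coind (fun f => exists c, f = fun=> c)); last by exists c.
move=> _ [k ->]; split; first by move=> x; exact: derivable_cst.
by exists 0; apply: derive1_is_derive => x; exact: is_derive_cst.
Qed.

Lemma rsmooth_alg f : smooth_alg f -> rsmooth f.
Proof.
apply: rsmooth_coind => {f} f; elim=> {f}.
- by move=> f sf; split; [exact: sf 0%N|apply: smooth_base; exact: rsmooth_derive].
- move=> f g _ [df sf] _ [dg sg].
  have D (x : R) : is_derive x 1 (fun x => f x + g x) (f^`()%classic x + g^`()%classic x).
    by apply: is_deriveD; exact: derivable_is_derive.
  split; first by move=> x; case: (D x).
  by rewrite (derive1_is_derive D); exact: smooth_add.
- move=> f g af [df sf] ag [dg sg].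
  have D (x : R) : is_derive x 1 (fun x => f x * g x)
      (f x * g^`()%classic x + g x * f^`()%classic x).
    by apply: is_deriveM; exact: derivable_is_derive.
  split; first by move=> x; case: (D x).
  by rewrite (derive1_is_derive D); apply: smooth_add; exact: smooth_mul.
- move=> f c e af [df sf].
  have D (x : R) : is_derive x 1 (fun x => f (c * x + e)) (f^`()%classic (c * x + e) * c).
    apply: (@is_derive1_comp _ f (fun x => c * x + e)).
      exact: derivable_is_derive.
    by apply: is_derive_eq; rewrite addr0 /GRing.scale/= mulr1.
  split; first by move=> x; case: (D x).
  rewrite (derive1_is_derive D); apply: smooth_mul.
    exact: (@smooth_affine _ c e sf).
  by apply: smooth_base; exact: rsmooth_cst.
Qed.

Lemma rsmoothD f g : rsmooth f -> rsmooth g -> rsmooth (fun x => f x + g x).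
Proof. by move=> sf sg; apply/rsmooth_alg/smooth_add; exact: smooth_base. Qed.

Lemma rsmoothM f g : rsmooth f -> rsmooth g -> rsmooth (fun x => f x * g x).
Proof. by move=> sf sg; apply/rsmooth_alg/smooth_mul; exact: smooth_base. Qed.

Lemma rsmooth_comp_affine f c e : rsmooth f -> rsmooth (fun x => f (c * x + e)).
Proof. by move=> sf; apply/rsmooth_alg/smooth_affine; exact: smooth_base. Qed.

Lemma rsmoothX f m : rsmooth f -> rsmooth (fun x => f x ^+ m).
Proof.
move=> sf; elim: m => [|m IH]; first exact: rsmooth_cst.
by under eq_fun do rewrite exprS; exact: rsmoothM.
Qed.

(** For y >= 0, y^i <= i! e^y by comparison with a single term of the exponential series; the
    constant adds up these estimates. *)
Lemma horner_le_expR p : exists2 C : R, 0 <= C & forall y, 0 <= y -> `|p.[y]| <= C * expR y.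
Proof.
exists (\sum_(i < size p) `|p`_i| * i`!%:R).
  by apply: sumr_ge0 => i _; rewrite mulr_ge0.
move=> y y0; rewrite horner_coef (le_trans (ler_norm_sum _ _ _))// mulr_suml.
apply: ler_sum => i _; rewrite normrM -mulrA ler_wpM2l//.
rewrite ger0_norm ?exprn_ge0//; case: (nat_of_ord i) => [|k].
  by rewrite expr0 fact0 mul1r (le_trans _ (expR_ge1Dx y))// lerDl.
rewrite mulrC -ler_pdivrMr ?ltr0n ?fact_gt0//.
by rewrite (le_trans _ (expR_ge1Dxn k y0))// lerDr.
Qed.

(** The functions p(1/x) e^(-1/x), extended by 0. The family contains the classical flat function as
    [flat 1] and, unlike that single function, is stable under derivation. *)
Definition flat p (x : R) : R := if 0 < x then p.[x^-1] * expR (- x^-1) else 0.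

Lemma is_derive_quadratic f (x C : R) :
  (forall h, `|f (x + h) - f x| <= C * h ^+ 2) -> is_derive x 1 f 0.
Proof.
move=> fC; have C1 : 0 < `|C| + 1 by rewrite ltr_wpDl.
have lim0 : h^-1 *: (f (h *: (1 : R) + x) - f x) @[h --> 0^'] --> (0 : R).
  apply/cvgrPdist_le => e e0.
  exists (e / (`|C| + 1)); first by rewrite /= divr_gt0.
  move=> h /=; rewrite sub0r normrN => he h0.
  rewrite sub0r normrN /GRing.scale/= mulr1 normrM normfV.
  rewrite ler_pdivrMl ?normr_gt0// (addrC h) (le_trans (fC h))//.
  
  rewrite -(real_normK (num_real h)) expr2 mulrCA ler_wpM2l//.
  rewrite (le_trans (_ : _ <= (`|C| + 1) * `|h|))//.
    by rewrite ler_wpM2r// (le_trans (ler_norm _))// lerDl.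
  by rewrite mulrC -ler_pdivlMr// ltW.
by apply: DeriveDef; [apply/cvg_ex; exists 0|exact/cvg_lim].
Qed.

(** In the variable y = 1/x, d/dx is -y^2 d/dy, which sends p(y) e^(-y) to y^2 (p - p')(y) e^(-y).
    At 0 a quadratic bound gives derivative 0. *)
Lemma is_derive_flat p (x : R) : is_derive x 1 (flat p) (flat ('X^2 * (p - p^`())) x).
Proof.
have [x0|x0|->] := ltrgt0P x.
- have near0 : \near x, p.[x^-1] * expR (- x^-1) = flat p x.
    near=> y; rewrite /flat ifT//; near: y; exact: lt_nbhsr.
  apply: near_eq_is_derive near0 _; rewrite /flat x0.
  have dV : is_derive x 1 (fun y : R => y^-1) (- x ^- 2).
    have := @is_deriveV R id x 1 1; rewrite gt_eqF// => /(_ isT (is_derive_id _ _)).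
    by rewrite /GRing.scale/= mulr1.
  have d1 : is_derive x 1 (fun y => p.[y^-1]) (p^`().[x^-1] * - x ^- 2).
    exact: (@is_derive1_comp _ (horner p) (fun y => y^-1)).
  have d2 : is_derive x 1 (fun y : R => expR (- y^-1)) (expR (- x^-1) * x ^- 2).
    apply: (@is_derive1_comp _ expR (fun y => - y^-1)).
    by rewrite -[x ^- 2]opprK; exact: is_deriveN.
  apply: (is_derive_eq (is_deriveM d1 d2)).
  by rewrite /GRing.scale/= hornerM hornerXn hornerD hornerN exprVn; ring.
- have near0 : \near x, cst 0 x = flat p x.
    near=> y; rewrite /flat ifF//; apply/negbTE; rewrite -leNgt ltW//.
    by near: y; exact: lt_nbhsl.
  apply: near_eq_is_derive near0 _; rewrite /flat ifN; last by rewrite -leNgt ltW.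
  exact: is_derive_cst.
- rewrite [X in is_derive _ _ _ X](_ : _ = 0); last by rewrite /flat ltxx.
  (* The extra factor X^2 turns the exponential bound at [h^-1] into a bound of [flat p h] by
     [C * h ^+ 2]. *)
  have [C C0 hC] := horner_le_expR ('X^2 * p).
  apply: (@is_derive_quadratic _ _ C) => h; rewrite add0r {2}/flat ltxx subr0 /flat.
  case: ifPn => h0; last by rewrite normr0 mulr_ge0 ?sqr_ge0.
  rewrite normrM (ger0_norm (expR_ge0 _)) expRN ler_pdivrMr ?expR_gt0//.
  have := hC h^-1; rewrite invr_ge0 ltW// => /(_ isT).
  rewrite hornerM hornerXn normrM ger0_norm ?sqr_ge0// exprVn.
  rewrite ler_pdivrMl ?exprn_gt0//; first by rewrite mulrA (mulrC C).
Unshelve. all: by end_near. Qed.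

Lemma rsmooth_flat p : rsmooth (flat p).
Proof.
apply: (@rsmooth_coind (fun f => exists p, f = flat p)); last by exists p.
move=> _ [q ->]; split; first by move=> x; have [] := is_derive_flat q x.
by exists ('X^2 * (q - q^`())); apply: derive1_is_derive; exact: is_derive_flat.
Qed.

Lemma flat1_ge0 x : 0 <= flat 1 x.
Proof. by rewrite /flat; case: ifP => // _; rewrite hornerC mul1r expR_ge0. Qed.

Lemma flat1_lt1 x : flat 1 x < 1.
Proof.
rewrite /flat; case: ifP => // x0.
by rewrite hornerC mul1r expR_lt1 oppr_lt0 invr_gt0.
Qed.

Lemma flat1_gt0 x : (0 < flat 1 x) = (0 < x).
Proof.
rewrite /flat; case: ifP => _; last exact: ltxx.
by rewrite hornerC mul1r expR_gt0.
Qed.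

Definition bump s t (x : R) : R := flat 1 (x - s) * flat 1 (t - x).

Lemma bump_ge0 s t x : 0 <= bump s t x.
Proof. by rewrite mulr_ge0 ?flat1_ge0. Qed.

Lemma bump_lt1 s t x : bump s t x < 1.
Proof.
rewrite /bump (le_lt_trans _ (flat1_lt1 (x - s)))//.
by rewrite ler_piMr ?flat1_ge0// ltW ?flat1_lt1.
Qed.

Lemma bump_gt0 s t x : s < x < t -> 0 < bump s t x.
Proof. by move=> /andP[sx xt]; rewrite mulr_gt0 ?flat1_gt0 ?subr_gt0. Qed.

Lemma bump_eq0 s t x : ~~ (s < x < t) -> bump s t x = 0.
Proof.
rewrite negb_and -!leNgt => /orP[xs|tx]; rewrite /bump.
  by rewrite [X in X * _](_ : _ = 0) ?mul0r// /flat ltNge subr_le0 xs.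
by rewrite [X in _ * X](_ : _ = 0) ?mulr0// /flat ltNge subr_le0 tx.
Qed.

Lemma rsmooth_bump s t : rsmooth (bump s t).
Proof.
apply: rsmoothM.
  have := @rsmooth_comp_affine (flat 1) 1 (- s) (@rsmooth_flat 1).
  by under eq_fun do rewrite mul1r.
have := @rsmooth_comp_affine (flat 1) (-1) t (@rsmooth_flat 1).
by under eq_fun do rewrite mulN1r addrC.
Qed.

(** [1 - bump s t] takes values in ]0, 1] and is below 1 exactly on ]s, t[, so its powers tend to 0
    there and stay 1 elsewhere. All these functions vanish off ]s, t[, whatever [m] is. *)
Definition plateau s t m (x : R) : R := 1 - (1 - bump s t x) ^+ m.

Lemma rsmooth_plateau s t m : rsmooth (plateau s t m).
Proof.
have sB f : rsmooth f -> rsmooth (fun x => 1 - f x).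
  move=> sf; under eq_fun do rewrite -mulN1r.
  by apply: rsmoothD; [|apply: rsmoothM => //]; exact: rsmooth_cst.
by apply: (sB); apply: rsmoothX; apply: (sB); exact: rsmooth_bump.
Qed.

Lemma plateau_norm s t m x : `|plateau s t m x| <= 1.
Proof.
have b1 : 0 <= 1 - bump s t x <= 1.
  by rewrite subr_ge0 (ltW (bump_lt1 _ _ _)) lerBlDr lerDl bump_ge0.
rewrite ger0_norm /plateau.
  by rewrite lerBlDr lerDl exprn_ge0//; case/andP: b1.
by rewrite subr_ge0 exprn_ile1//; case/andP: b1.
Qed.

Lemma plateau_eq0 s t m x : ~~ (s < x < t) -> plateau s t m x = 0.
Proof. by move=> h; rewrite /plateau bump_eq0// subr0 expr1n subrr. Qed.

Lemma plateau_cvg s t x : plateau s t m x @[m --> \oo] --> ((s < x < t)%R%:R : R).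
Proof.
have [h|h] := boolP (s < x < t); last first.
  rewrite (_ : (fun m => _) = fun=> 0); first exact: cvg_cst.
  by apply/funext => m; rewrite plateau_eq0.
rewrite -[X in _ --> X]subr0; apply: cvgB; first exact: cvg_cst.
apply: cvg_expr; rewrite ger0_norm.
  by rewrite ltrBlDr ltrDl bump_gt0.
by rewrite subr_ge0 (ltW (bump_lt1 _ _ _)).
Qed.

End smooth_functions.

(* Otherwise comparing two integrands can make unification unfold [expR]. *)
Global Opaque flat bump plateau.

Section du_bois_reymond.
Context {R : realType}.
Notation mu := (@lebesgue_measure R).
Implicit Types (f g z : R -> R).

Lemma Rintegral_dominated_cvg d (T : measurableType d) (nu : {measure set T -> \bar R})
    (D : set T) (f_ : nat -> T -> R) (f g : T -> R) : measurable D ->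
  (forall m, measurable_fun D (f_ m)) -> measurable_fun D f ->
  {ae nu, forall x, D x -> f_ m x @[m --> \oo] --> f x} ->
  nu.-integrable D (EFin \o g) -> (forall m x, D x -> `|f_ m x| <= g x) ->
  \int[nu]_(x in D) f_ m x @[m --> \oo] --> \int[nu]_(x in D) f x.
Proof.
move=> mD mf_ mf cf ig fg.
have [||||if_ _ cI] := @dominated_convergence _ _ _ nu D mD
  (fun m => EFin \o f_ m) (EFin \o f) (EFin \o g) _ _ _ ig _.
- by move=> m; exact/measurable_EFinP.
- exact/measurable_EFinP.
- by apply: aeS cf => x cf Dx; apply: cvg_EFin; [exact: nearW|exact: cf].
- by apply: aeW => x m Dx /=; rewrite lee_fin fg.
apply: fine_cvg; rewrite fineK//.
exact: integrable_fin_num.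
Qed.

Section interval.
Variables (a b : R).
Hypothesis ab : a < b.
Let I : set (measurableTypeR R) := `]a, b[%classic.
Let mI : measurable I. Proof. exact: measurable_itv. Qed.

Let muI : (mu I < +oo)%E.
Proof. by rewrite lebesgue_measure_itv/=; case: ifP => // _; rewrite -EFinB ltry. Qed.

Lemma measurable_rsmooth f (D : set (measurableTypeR R)) : rsmooth f -> measurable_fun D f.
Proof.
move=> sf; apply: (@measurable_funS _ _ _ _ setT) => //.
apply: continuous_measurable_fun => x.
by apply/differentiable_continuous/derivable1_diffP; exact: rsmooth_derivable.
Qed.

Lemma measurable_plateau s t m (D : set (measurableTypeR R)) : measurable_fun D (plateau s t m).
Proof. by apply: measurable_rsmooth; exact: rsmooth_plateau. Qed.

Lemma plateau_integral_cvg s t z : a <= s -> t <= b ->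
  mu.-integrable I (EFin \o z) ->
  \int[mu]_(x in I) (plateau s t m x * z x) @[m --> \oo] -->
  \int[mu]_(x in `]s, t[) z x.
Proof.
move=> as_ tb iz.
have sub : `]s, t[%classic `<=` I.
  by apply: subset_itv; rewrite bnd_simp.
have -> : \int[mu]_(x in `]s, t[) z x = \int[mu]_(x in I) (z \_ `]s, t[) x.
  by rewrite -Rintegral_mkcondr (_ : I `&` _ = `]s, t[%classic)//; exact/setIidPr.
have mz : measurable_fun I z by apply/measurable_EFinP; case/integrableP : iz.
apply: (@Rintegral_dominated_cvg _ _ _ I _ _ (fun x => `|z x|)) => //.
- by move=> m; apply: measurable_funM => //; exact: measurable_plateau.
- apply/measurable_restrict => //.
  by apply: measurable_funS mz => //; exact: subIsetl.
- apply: aeW => x Ix; rewrite patchE mem_setE.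
  rewrite [X in _ --> X](_ : _ = (s < x < t)%R%:R * z x); last first.
    by rewrite in_itv/=; case: ifP => _; rewrite ?mul1r ?mul0r.
  by apply: cvgM; [exact: plateau_cvg|exact: cvg_cst].
- exact: integrable_norm.
- move=> m x _; rewrite normrM ler_piMl//; exact: plateau_norm.
Qed.

(* Testing with the primitive of a combination of two plateau functions shows
   that the averages of [z] over any two subintervals agree. *)
Lemma du_bois_reymond z : mu.-integrable I (EFin \o z) ->
  (forall (phi : R -> R) (p q : R), rsmooth phi -> a < p -> q < b ->
    (forall x, ~~ (p <= x <= q) -> phi x = 0) ->
    \int[mu]_(x in I) (phi^`()%classic x * z x) = 0) ->
  exists k, {ae mu, forall x : R, x \in `]a, b[ -> z x = k}.
Proof.
move=> iz tz.
have i1 : mu.-integrable I (EFin \o cst 1).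
  apply: measurable_bounded_integrable => //.
  by exists 1; split => // M M1 x _ /=; rewrite normr1 ltW.
(* The factor [cst 1] lets the auxiliary facts [ipl] and [thE] serve for 1 and for [z] alike. *)
have test s t s0 t0 m : a < s -> t < b -> a < s0 -> t0 < b ->
    \int[mu]_(x in I) (plateau s0 t0 m x * cst 1 x) * \int[mu]_(x in I) (plateau s t m x * z x) =
    \int[mu]_(x in I) (plateau s t m x * cst 1 x) * \int[mu]_(x in I) (plateau s0 t0 m x * z x).
  move=> as_ tb as0 tb0.
  move E0 : (\int[mu]_(x in I) (plateau s0 t0 m x * cst 1 x)) => c0.
  move E1 : (\int[mu]_(x in I) (plateau s t m x * cst 1 x)) => c1.
  (* These coefficients give [theta] integral 0, so its primitive vanishes to the right of [q] as
     well as to the left of [p] and is an admissible test function. *)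
  pose theta (x : R) := c0 * plateau s t m x + - c1 * plateau s0 t0 m x.
  have sth : rsmooth theta.
    exact: (rsmoothD (rsmoothM (@rsmooth_cst R c0) (@rsmooth_plateau R s t m))
                     (rsmoothM (@rsmooth_cst R (- c1)) (@rsmooth_plateau R s0 t0 m))).
  pose p := Num.min s s0; pose q := Num.max t t0.
  have ap : a < p by rewrite lt_min as_.
  have qb : q < b by rewrite gt_max tb.
  have th0 x : ~~ (p <= x <= q) -> theta x = 0.
    move=> h; rewrite /theta !plateau_eq0 ?mulr0 ?addr0//.
      apply: contra h => /andP[s0x xt0].
      by rewrite ge_min le_max (ltW s0x) (ltW xt0) !orbT.
    apply: contra h => /andP[sx xt].
    by rewrite ge_min le_max (ltW sx) (ltW xt).
  have ipl s' t' (h : R -> R) : mu.-integrable I (EFin \o h) ->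
      mu.-integrable I (EFin \o (fun x => plateau s' t' m x * h x)).
    move=> ih; rewrite (_ : _ \o _ = ((EFin \o plateau s' t' m) \* (EFin \o h))%E).
      apply: integrableMr => //; first exact: measurable_plateau.
      exists 1; split; first exact: num_real.
      by move=> M M1 x _; apply: le_trans (plateau_norm _ _ _ _) _; exact: ltW.
    by apply/funext => x /=; rewrite EFinM.
  have thE (h : R -> R) : mu.-integrable I (EFin \o h) ->
      \int[mu]_(x in I) (theta x * h x) =
      c0 * \int[mu]_(x in I) (plateau s t m x * h x) -
      c1 * \int[mu]_(x in I) (plateau s0 t0 m x * h x).
    move=> ih.
    have i2 := ipl s t h ih; have i3 := ipl s0 t0 h ih.
    transitivity (\int[mu]_(x in I)
        (c0 * (plateau s t m x * h x) - c1 * (plateau s0 t0 m x * h x))).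
      by apply: eq_Rintegral => x _; rewrite /theta; ring.
    rewrite RintegralB//; [|exact: integrableZR|exact: integrableZR].
    by congr (_ - _); exact: RintegralZl.
  have thp : theta = theta \_ `[p, q].
    apply/funext => x; rewrite patchE mem_setE in_itv/=.
    by case: ifPn => // /th0.
  have ith : mu.-integrable setT (EFin \o theta).
    rewrite thp; apply: integrable_patch; first exact: measurable_itv.
    apply: continuous_compact_integrable; first exact: segment_compact.
    apply: continuous_subspaceT => x.
    by apply/differentiable_continuous/derivable1_diffP; exact: rsmooth_derivable.
  have dth (x : R) : is_derive x 1 (prim theta) (theta x).
    have [||||dp <-] := @continuous_FTC1 R theta -oo%O x (x + 1).
    - by rewrite ltrDl.
    - by apply: integrableS ith => //; exact: measurable_itv.
    - by rewrite ltNyr.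
    - by apply/differentiable_continuous/derivable1_diffP; exact: rsmooth_derivable.
    by apply: derivable_is_derive.
  have pth0 x : ~~ (p <= x <= q) -> prim theta x = 0.
    move=> h; rewrite /prim thp Rintegral_patch.
    have [xp|px] := ltP x p.
      rewrite (_ : _ `&` _ = set0) ?Rintegral_set0// -subset0 => y [] /=.
      by rewrite !in_itv/= => /le_lt_trans/(_ xp) yp /andP[]; rewrite leNgt yp.
    have {h} qx : q < x by move: h; rewrite px/= -ltNge.
    rewrite (_ : _ `&` _ = I `&` `[p, q]); last first.
      transitivity (`[p, q]%classic : set R); [apply/setIidPr|apply/esym/setIidPr] => y.
      + by rewrite /= !in_itv/= => /andP[py yq]; rewrite (le_trans yq (ltW qx)).
      + by rewrite /I /= !in_itv/= => /andP[py yq]; rewrite (lt_le_trans ap py) (le_lt_trans yq qb).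
    rewrite -Rintegral_patch -thp.
    have <- : \int[mu]_(x in I) (theta x * cst 1 x) = 0.
      by rewrite thE// E0 E1 (mulrC c0) subrr.
    by apply: eq_Rintegral => x0 _; rewrite mulr1.
  have := tz (prim theta) p q (rsmooth_primitive dth sth) ap qb pth0.
  by rewrite (derive1_is_derive dth) (thE z iz) => /eqP; rewrite subr_eq0 => /eqP.
(* As [m] tends to infinity, the plateau integrals become lengths of intervals and integrals of [z]
   over them. *)
have lim_test s t s0 t0 : a < s -> s <= t -> t < b -> a < s0 -> s0 <= t0 -> t0 < b ->
    (t0 - s0) * \int[mu]_(x in `]s, t[) z x = (t - s) * \int[mu]_(x in `]s0, t0[) z x.
  move=> as_ st tb as0 st0 tb0.
  have len u v : u <= v -> \int[mu]_(x in `]u, v[) cst 1 x = v - u.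
    move=> uv; rewrite Rintegral_cst//= mul1r lebesgue_measure_itv/= lte_fin.
    by move: uv; rewrite le_eqVlt => /predU1P[->|->]; rewrite ?ltxx ?subrr.
  have cvg1 u v u' v' : a < u -> u <= v -> v < b -> a < u' -> v' < b ->
      (\int[mu]_(x in I) (plateau u v m x * cst 1 x)) *
      (\int[mu]_(x in I) (plateau u' v' m x * z x)) @[m --> \oo] -->
      (v - u) * \int[mu]_(x in `]u', v'[) z x.
    move=> au uv vb au' vb'; rewrite -len//.
    apply: cvgM; apply: plateau_integral_cvg => //; exact: ltW.
  have c1 := cvg1 _ _ _ _ as0 st0 tb0 as_ tb.
  have c2 := cvg1 _ _ _ _ as_ st tb as0 tb0.
  rewrite (funext (fun m => test s t s0 t0 m as_ tb as0 tb0)) in c1.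
  exact: (cvg_unique (@Rhausdorff R) c1 c2).
(* A fixed reference interval inside ]a, b[; the constant [k] is the mean of [z] over it. *)
pose t0 := (a + b) / 2; pose s0 := (a + t0) / 2.
have [at0 tb0] : a < t0 /\ t0 < b by rewrite !midf_lt.
have [as0 st0] : a < s0 /\ s0 < t0 by rewrite !midf_lt.
pose k := \int[mu]_(x in `]s0, t0[) z x / (t0 - s0).
have iz' := integrable_patch mI iz.
have pk s t : a < s -> s <= t -> t < b ->
    prim (z \_ I) t - prim (z \_ I) s = k * (t - s).
  move=> as_ st tb; rewrite primB// -Rintegral_itv_bndo_bndc; last first.
    by apply: integrableS iz' => //; exact: measurable_itv.
  rewrite Rintegral_patch (_ : _ `&` _ = `]s, t[%classic); last first.
    apply/setIidPl => x; rewrite /I /= !in_itv/= => /andP[sx xt].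
    by rewrite (lt_trans as_ sx) (lt_trans xt tb).
  have tsn0 : t0 - s0 != 0 by rewrite subr_eq0 gt_eqF.
  apply: (mulfI tsn0); rewrite (lim_test s t s0 t0)//; last exact: ltW.
  by rewrite /k mulrA (mulrC (t0 - s0)) divfK// mulrC.
(* Near [x] the primitive is affine with slope [k], while almost everywhere its derivative is
   [z x]. *)
exists k; apply: aeS (prim_derive iz') => x dx xI.
rewrite patchE mem_set// in dx.
have near_x : \near x, prim (z \_ I) t0 + k * (x - t0) = prim (z \_ I) x.
  have := @near_in_itvoo R a b x xI; apply: filterS => y; rewrite in_itv/= => /andP[ay yb].
  have [yt|ty] := leP y t0; last by rewrite -pk ?(ltW ty) ?(lt_trans as0)//; ring.
  rewrite -[in RHS](subrK (prim (z \_ I) t0) (prim _ y)) addrC; congr (_ + _).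
  by rewrite -[RHS]opprB pk//; ring.
have dx' : is_derive x 1 (prim (z \_ I)) k.
  apply: near_eq_is_derive near_x _.
  by apply: is_derive_eq; rewrite subr0 add0r mul1r /GRing.scale/= mulr1.
by case: dx => _ <-; case: dx'.
Qed.

End interval.

End du_bois_reymond.

(** * Approximation by Lipschitz functions vanishing near the endpoints *)

Section density.
Context {R : realType}.
Notation mu := (@lebesgue_measure R).

Lemma measurable_shift (h : R) :
  measurable_fun (setT : set (measurableTypeR R)) (fun x : measurableTypeR R => x + h : measurableTypeR R).
Proof. by apply: measurable_funD => //; exact: measurable_cst. Qed.

(** The pushforward of Lebesgue measure under a translation has the right value on half-open
    intervals, which determines it. *)
Lemma lebesgue_measure_shift (h : R) (A : set (measurableTypeR R)) : measurable A ->
  mu [set x | A (x + h)] = mu A.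
Proof.
have mh := measurable_shift h.
move=> mA; apply/esym.
apply: (@lebesgue_measure_unique R (pushforward mu (fun x : measurableTypeR R => x + h : measurableTypeR R))) => // _ [[a b] _ <-].
rewrite /= /pushforward (_ : _ @^-1` _ = `](a - h), (b - h)]%classic).
  rewrite !lebesgue_measure_itv/= !lte_fin ltrD2r.
  by case: ifP => // _; rewrite -!EFinB; congr (_%:E); ring.
by apply/seteqP; split => x /=; rewrite !in_itv/= ltrBlDr lerBrDr.
Qed.

Lemma ae_shift (h : R) (P : R -> Prop) :
  {ae mu, forall x, P x} -> {ae mu, forall x, P (x + h)}.
Proof.
move=> [N [mN N0 sN]]; exists [set x | N (x + h)]; split.
- rewrite -[X in measurable X]setTI; exact: (measurable_shift h).
- by rewrite lebesgue_measure_shift.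
- by move=> x /= nP; apply: sN.
Qed.

Section difference_quotient.
Variables (w : R -> R) (K : R) (a b : R).
Hypothesis mw : measurable_fun (setT : set (measurableTypeR R)) w.
Hypothesis wK : forall x, `|w x| <= K.
Hypothesis w0 : forall x, ~~ (a <= x <= b) -> w x = 0.

Lemma bounded_supp_integrable : mu.-integrable setT (EFin \o w).
Proof.
rewrite (_ : w = w \_ `[a, b]).
  apply: integrable_patch; first exact: measurable_itv.
  have fin : (mu `[a, b] < +oo)%E.
    by rewrite lebesgue_measure_itv/=; case: ifP => // _; rewrite -EFinB ltry.
  apply: measurable_bounded_integrable => //.
  - exact: measurable_funTS.
  - exists K; split; first exact: num_real.
    by move=> M KM x _; apply: le_trans (wK x) (ltW KM).
apply/funext => x; rewrite patchE mem_setE in_itv/=.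
by case: ifPn => // /w0.
Qed.
Let iw := bounded_supp_integrable.

Lemma prim_lipschitz x y : `|prim w x - prim w y| <= K * `|x - y|.
Proof.
wlog yx : x y / y <= x.
  move=> h; have [|/ltW] := leP y x; first exact: h.
  by move=> /h; rewrite distrC (distrC x).
rewrite primB// (le_trans (le_normr_Rintegral _ _))//.
  by apply: integrableS iw => //; exact: measurable_itv.
have len : K * `|x - y| = \int[mu]_(t in `]y, x]) cst K t.
  rewrite Rintegral_cst//= lebesgue_measure_itv/= lte_fin ger0_norm ?subr_ge0//.
  by move: yx; rewrite le_eqVlt => /predU1P[->|->]; rewrite ?ltxx ?subrr.
rewrite len; apply: le_Rintegral => //.
- by apply: integrable_norm; apply: integrableS iw => //; exact: measurable_itv.
- have fin : (mu `]y, x] < +oo)%E.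
    by rewrite lebesgue_measure_itv/=; case: ifP => // _; rewrite -EFinB ltry.
  apply: measurable_bounded_integrable => //.
  by exists `|K|; split => [|M KM t _ /=]; [exact: num_real|exact: ltW].
Qed.

(** For h > 0 this is the mean of [w] over [x, x + h]. It is therefore bounded by [K] uniformly in
    [h], which provides the domination, although the Lipschitz constant 2K/|h| blows up. *)
Definition quotient h x := h^-1 * (prim w (x + h) - prim w x).

Lemma quotient_bounded h x : 0 < h -> `|quotient h x| <= K.
Proof.
move=> h0; rewrite /quotient normrM normfV ler_pdivrMl ?normr_gt0 ?gt_eqF//.
by rewrite (le_trans (prim_lipschitz _ _))// addrAC subrr add0r mulrC.
Qed.

Lemma quotient_lipschitz h x y :
  `|quotient h x - quotient h y| <= (`|h|^-1 * (K + K)) * `|x - y|.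
Proof.
rewrite /quotient -mulrBr normrM normfV -mulrA ler_wpM2l ?invr_ge0//.
rewrite (_ : _ - _ - _ = (prim w (x + h) - prim w (y + h)) - (prim w x - prim w y)); last by ring.
rewrite (le_trans (ler_normB _ _))// mulrDl lerD ?prim_lipschitz//.
rewrite (le_trans (prim_lipschitz _ _))// (_ : x + h - _ = x - y)//; ring.
Qed.

Lemma quotient_derive h :
  {ae mu, forall x : R, is_derive x 1 (quotient h) (h^-1 * (w (x + h) - w x))}.
Proof.
have d1 := prim_derive iw; have d2 := ae_shift h d1.
apply: aeS2 d1 d2 => x d1 d2.
have ds : is_derive x 1 (fun x : R => x + h) 1.
  by apply: is_derive_eq; rewrite addr0.
have d3 : is_derive x 1 (fun x => prim w (x + h)) (w (x + h)).
  by rewrite -[X in is_derive _ _ _ X]mulr1; exact: (@is_derive1_comp _ (prim w) (fun x => x + h)).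
have d4 := is_deriveB d3 d1.
exact: (is_deriveZ h^-1 d4).
Qed.

Lemma quotient_cvg : {ae mu, forall x, quotient m.+1%:R^-1 x @[m --> \oo] --> w x}.
Proof.
apply: aeS (prim_derive iw) => x [/cvg_ex[l Hl] dE].
have El : l = w x by rewrite -dE; apply/esym/cvg_lim.
move: Hl; rewrite El => /cvgrPdist_le Hl; apply/cvgrPdist_le => e e0.
have [r /= r0 hr] := Hl e e0.
have := near_infty_natSinv_lt (PosNum r0); apply: filterS => m /= mr.
have m0 : m.+1%:R^-1 != 0 :> R by rewrite invr_neq0.
have := hr m.+1%:R^-1; rewrite /ball/= sub0r normrN gtr0_norm ?invr_gt0// => /(_ mr m0).
by rewrite /GRing.scale/= mulr1 /quotient (addrC x).
Qed.

End difference_quotient.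

Section approximation.
Variables (n : nat) (alpha beta : 'I_n -> R).
Hypothesis alpha_lt_beta : forall i : 'I_n, alpha i < beta i.
Hypothesis beta_lt_alpha : forall i j : 'I_n, j = i.+1 :> nat -> beta i < alpha j.
Local Notation Om := (Omega alpha beta).
Local Notation muO := (mu_Omega alpha beta).
Variable u : R -> R.
Hypothesis mu_ : measurable_fun (setT : set (measurableTypeR R)) u.
Hypothesis iu : muO.-integrable setT (EFin \o (fun x => u x ^+ 2)).

(** The margin [m.+1%:R^-1] at each endpoint leaves room for averaging, and the cut at height [m]
    makes the truncation bounded. *)
Definition core m : set (measurableTypeR R) :=
  (\bigcup_(i in [set: 'I_n]) `[alpha i + m.+1%:R^-1, beta i - m.+1%:R^-1]%classic) `&`
  [set x | `|u x| <= m%:R].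

Definition truncation m : R -> R := u \_ (core m).

Lemma measurable_core m : measurable (core m).
Proof.
apply: measurableI.
  by apply: fin_bigcup_measurable => // i _; exact: measurable_itv.
rewrite -[X in measurable X]setTI.
have -> : [set: measurableTypeR R] `&` [set x | `|u x| <= m%:R] =
    setT `&` u @^-1` `[- m%:R, m%:R]%classic.
  by rewrite !setTI; apply/seteqP; split => x /=; rewrite in_itv/= ler_norml.
by apply: mu_ => //; exact: measurable_itv.
Qed.

Lemma measurable_truncation m : measurable_fun (setT : set (measurableTypeR R)) (truncation m).
Proof.
apply: (measurable_restrictT _ (measurable_core m)).1.
exact: measurable_funTS.
Qed.

Lemma truncation_bounded m x : `|truncation m x| <= m%:R.
Proof.
rewrite /truncation patchE; case: ifPn => [/set_mem[_ //]|_].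
by rewrite normr0.
Qed.

(** A given point of Omega lies in [core m] for all large [m], so the sequence is eventually 0. *)
Lemma truncation_cvg (x : R) : Om x -> (u x - truncation m x) ^+ 2 @[m --> \oo] --> (0 : R).
Proof.
move=> [i _]; rewrite /= in_itv/= => /andP[ax xb].
have xa0 : 0 < x - alpha i by rewrite subr_gt0.
have bx0 : 0 < beta i - x by rewrite subr_gt0.
apply: cvg_near_cst.
apply: filterS3 (nbhs_infty_ger `|u x|) (near_infty_natSinv_lt (PosNum bx0))
  (near_infty_natSinv_lt (PosNum xa0)) => m um mb ma.
rewrite /truncation patchE mem_set ?subrr ?expr0n//.
split => //; exists i => //=; rewrite in_itv/=.
by move: (m.+1%:R^-1) ma mb => /= r ma mb; apply/andP; split; lra.
Qed.

Lemma truncation_integral_cvg :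
  \int[muO]_x ((u x - truncation m x) ^+ 2) @[m --> \oo] --> (0 : R).
Proof.
have -> : (0 : R) = \int[muO]_x (cst 0 x) by rewrite Rintegral_cst// mul0r.
apply: (@Rintegral_dominated_cvg _ _ _ muO setT _ _ (fun x => u x ^+ 2)) => //.
- move=> m; apply: measurable_funX; apply: measurable_funB => //.
  exact: measurable_truncation.
- by apply/ae_mrestr; apply: aeW => x Ox _; exact: truncation_cvg.
- move=> m x _; rewrite ger0_norm ?sqr_ge0// /truncation patchE.
  by case: ifP => _; rewrite ?subrr ?expr0n/= ?sqr_ge0// subr0.
Qed.

Lemma truncation_support (c x : R) m : ~ Om c -> `|x - c| < m.+1%:R^-1 -> truncation m x = 0.
Proof.
move=> Oc xc; rewrite /truncation patchE; case: ifPn => // /set_mem[[i _]].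
rewrite /= in_itv/= => /andP[h1 h2] _; exfalso; apply: Oc; exists i => //=.
have m0 : 0 < m.+1%:R^-1 :> R by rewrite invr_gt0.
move: xc; rewrite ltr_norml => /andP[h3 h4].
rewrite in_itv/=; move: (m.+1%:R^-1) m0 h1 h2 h3 h4 => r m0 h1 h2 h3 h4.
by apply/andP; split; lra.
Qed.

Lemma truncation_bounded_support m : exists a b : R, forall x, ~~ (a <= x <= b) -> truncation m x = 0.
Proof.
exists (- \sum_(i < n) (`|alpha i| + `|beta i|)), (\sum_(i < n) (`|alpha i| + `|beta i|)) => x xab.
rewrite /truncation patchE; case: ifPn => // /set_mem[[i _]].
rewrite /= in_itv/= => /andP[h1 h2] _; exfalso; move/negP: xab; apply.
have m0 : 0 < m.+1%:R^-1 :> R by rewrite invr_gt0.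
have le : `|alpha i| + `|beta i| <= \sum_(i < n) (`|alpha i| + `|beta i|).
  by rewrite (bigD1 i)//= lerDl sumr_ge0.
have := ler_norm (beta i); have := ler_norm (- alpha i); rewrite normrN.
have := normr_ge0 (beta i); have := normr_ge0 (alpha i).
move: (m.+1%:R^-1) m0 h1 h2 => r m0 h1 h2 *; apply/andP; split; lra.
Qed.

(** [v] is a running mean of a truncation of [u]. The Lipschitz constant [L] also bounds the
    derivative [g], and vanishing within distance [d] of the complement of Omega will give zero
    boundary values. *)
Lemma lipschitz_approximation (e : R) : 0 < e -> exists (v g : R -> R) (L K d : R),
  [/\ (forall x, `|v x| <= K) /\ (forall x y, `|v x - v y| <= L * `|x - y|),
      measurable_fun (setT : set (measurableTypeR R)) g /\ (forall x, `|g x| <= L),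
      {ae mu, forall x : R, is_derive x 1 v (g x)},
      0 < d /\ (forall c x, ~ Om c -> `|x - c| < d -> v x = 0) &
      \int[muO]_x ((u x - v x) ^+ 2) < e].
Proof.
(* There are two errors, and (p + q)^2 <= 2 p^2 + 2 q^2 doubles each of them. *)
move=> e0; have e40 : 0 < e / 4 by rewrite divr_gt0.
have [N hN] : exists N, \int[muO]_x ((u x - truncation N x) ^+ 2) < e / 4.
  have /cvgrPdist_lt /(_ _ e40) [N _ /(_ N (leqnn N))] := truncation_integral_cvg.
  rewrite /= sub0r normrN => /(le_lt_trans (ler_norm _)) hN; by exists N.
set w := truncation N in hN.
have mw : measurable_fun (setT : set (measurableTypeR R)) w by exact: measurable_truncation.
have wN : forall x, `|w x| <= N%:R by exact: truncation_bounded.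
have [a [b wab]] := truncation_bounded_support N.
have mv h : measurable_fun (setT : set (measurableTypeR R)) (quotient w h).
  apply: continuous_measurable_fun => x; apply/cvgrPdist_lt => r r0.
  set L := `|h|^-1 * (N%:R + N%:R).
  have L0 : 0 < L + 1 by rewrite ltr_wpDl// mulr_ge0 ?invr_ge0// addr_ge0.
  exists (r / (L + 1)); first by rewrite /= divr_gt0.
  move=> y /=; rewrite ltr_pdivlMr// => xy.
  rewrite (le_lt_trans (quotient_lipschitz mw wN wab _ _ _))//.
  by rewrite (le_lt_trans _ xy)// mulrC ler_wpM2l// lerDl.
have cvg0 : \int[muO]_x ((w x - quotient w m.+1%:R^-1 x) ^+ 2) @[m --> \oo] --> (0 : R).
  have -> : (0 : R) = \int[muO]_x (cst 0 x) by rewrite Rintegral_cst// mul0r.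
  apply: (@Rintegral_dominated_cvg _ _ _ muO setT _ _ (fun x => (N%:R + N%:R) ^+ 2)) => //.
  - by move=> m; apply: measurable_funX; exact: measurable_funB.
  - apply/ae_mrestr; apply: aeS (quotient_cvg mw wN wab) => x h _ _.
    have -> : cst 0 x = (w x - w x) ^+ 2 by rewrite subrr expr0n.
    under eq_fun do rewrite expr2.
    by rewrite expr2; apply: cvgM; apply: cvgB => //; exact: cvg_cst.
  - apply: measurable_bounded_integrable => //; first exact: mu_Omega_fin.
    exists ((N%:R + N%:R) ^+ 2); split; first exact: num_real.
    by move=> M KM x _ /=; rewrite ger0_norm ?sqr_ge0// ltW.
  - move=> m x _; rewrite ger0_norm ?sqr_ge0// -(real_normK (num_real (w x - _))).
    rewrite lerXn2r// ?nnegrE ?addr_ge0//.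
    rewrite (le_trans (ler_normB _ _))// lerD//.
    by apply: (quotient_bounded mw wN wab); rewrite invr_gt0.
(* The step is less than half the margin of the truncation: if [x] is within half the margin of a
   point outside Omega, the mean over [x, x + h] sees only zeros. *)
have [M [hM MN]] : exists M, \int[muO]_x ((w x - quotient w M.+1%:R^-1 x) ^+ 2) < e / 4 /\
    M.+1%:R^-1 < N.+1%:R^-1 / 2 :> R.
  have N20 : 0 < N.+1%:R^-1 / 2 :> R by rewrite divr_gt0 ?invr_gt0.
  have h1 := near_infty_natSinv_lt (PosNum N20).
  have /cvgrPdist_lt /(_ _ e40) h2 := cvg0.
  have [M _ /(_ M (leqnn M))[/= h3 h4]] := filterI h1 h2.
  exists M; split => //.
  by rewrite (le_lt_trans (ler_norm _))// -normrN -sub0r.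
set h := M.+1%:R^-1 : R.
have h0 : 0 < h by rewrite invr_gt0.
pose L := `|h|^-1 * (N%:R + N%:R).
exists (quotient w h), (fun x => h^-1 * (w (x + h) - w x)), L, N%:R, (N.+1%:R^-1 / 2).
split.
- split; first by move=> x; exact: (quotient_bounded mw wN wab).
  exact: (quotient_lipschitz mw wN wab).
- split.
    apply: measurable_funM; first exact: measurable_cst.
    apply: measurable_funB => //.
    exact: (measurableT_comp mw (measurable_shift h)).
  move=> x; rewrite normrM normfV ler_wpM2l ?invr_ge0//.
  by rewrite (le_trans (ler_normB _ _))// lerD.
- exact: (quotient_derive mw wN wab).
- split; first by rewrite divr_gt0 ?invr_gt0.
  move=> c x Oc xc; rewrite /quotient primB ?lerDl ?(ltW h0)//; last first.
    exact: (bounded_supp_integrable mw wN wab).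
  rewrite (@eq_Rintegral _ _ _ mu _ (cst 0)); last first.
    move=> y; rewrite inE/= in_itv/= => /andP[xy yxh].
    apply: (truncation_support Oc); move: xc; rewrite !ltr_norml => /andP[h1 h2].
    by move: MN h1 h2; rewrite -/h; move: (N.+1%:R^-1) => r MN h1 h2; apply/andP; split; lra.
  by rewrite Rintegral_cst ?mul0r ?mulr0//; exact: measurable_itv.
- have iw2 : muO.-integrable setT (EFin \o (fun x => w x ^+ 2)).
    exact: bounded_sqr_integrable wN.
  have iv2 : muO.-integrable setT (EFin \o (fun x => quotient w h x ^+ 2)).
    apply: (bounded_sqr_integrable _ _ (mv h)) => // x.
    exact: (quotient_bounded mw wN wab).
  have isq (p q : R -> R) : measurable_fun (setT : set (measurableTypeR R)) p ->
      measurable_fun (setT : set (measurableTypeR R)) q ->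
      muO.-integrable setT (EFin \o (fun x => p x ^+ 2)) ->
      muO.-integrable setT (EFin \o (fun x => q x ^+ 2)) ->
      muO.-integrable setT (EFin \o (fun x => (p x - q x) ^+ 2)).
    move=> mp mq ip iq; have := integrableDR measurableT ip iq.
    move=> /(integrableZR measurableT 2); apply: le_integrableR.
      by apply: measurable_funX; exact: measurable_funB.
    move=> x; rewrite !ger0_norm ?sqr_ge0 ?mulr_ge0 ?addr_ge0 ?sqr_ge0//.
    by have := sqr_ge0 (p x + q x); nra.
  have i1 := isq _ _ mu_ mw iu iw2; have i2 := isq _ _ mw (mv h) iw2 iv2.
  apply: (@le_lt_trans _ _ (\int[muO]_x (2 * (u x - w x) ^+ 2 + 2 * (w x - quotient w h x) ^+ 2))).
    apply: le_Rintegral => //; first exact: isq.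
      by apply: integrableDR => //; exact: integrableZR.
    by move=> x _; have := sqr_ge0 (u x - 2 * w x + quotient w h x); nra.
  rewrite RintegralD//; try exact: integrableZR.
  rewrite !RintegralZl//.
  by move: hN hM; rewrite -/h => hN hM; lra.
Qed.

End approximation.

End density.

Lemma ae_forall_ord d (T : measurableType d) (R : realType) (mu : {measure set T -> \bar R})
    n (P : 'I_n -> T -> Prop) : (forall i, {ae mu, forall x, P i x}) ->
  {ae mu, forall x, forall i, P i x}.
Proof.
move=> aeP; have h (m : nat) : {ae mu, forall x, forall i : 'I_n, i = m :> nat -> P i x}.
  have [mn|nm] := ltnP m n.
    apply: aeS (aeP (Ordinal mn)) => x Px i im.
    by rewrite (_ : i = Ordinal mn)//; exact/val_inj.
  by apply: aeW => x i im; move: (ltn_ord i); rewrite im ltnNge nm.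
by apply: aeS (ae_foralln h) => x Px i; exact: (Px i).
Qed.

(** * The maximal domain *)

Section maximal_domain.
Context {R : realType} (n : nat) (alpha beta : 'I_n -> R).
Hypothesis alpha_lt_beta : forall i : 'I_n, alpha i < beta i.
Hypothesis beta_lt_alpha : forall i j : 'I_n, j = i.+1 :> nat -> beta i < alpha j.
Notation mu := (@lebesgue_measure R).
Local Notation Om := (Omega alpha beta).
Local Notation muO := (mu_Omega alpha beta).
Local Notation I i := (`]alpha i, beta i[%classic : set (measurableTypeR R)).
Local Notation mfun p := (measurable_fun (setT : set (measurableTypeR R)) p).
Implicit Types (p q : R -> R).

(* [(p, p')] is the real or imaginary part of a pair [(f, f')] with [f] in
   [D_max]. *)
Definition rmaxd p (p' : R -> R) := [/\ mfun p, mfun p',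
  muO.-integrable setT (EFin \o (fun x => p x ^+ 2)),
  muO.-integrable setT (EFin \o (fun x => p' x ^+ 2)) &
  forall i, racont (I i) p /\
    {ae mu, forall x : R, x \in `]alpha i, beta i[ -> is_derive x 1 p (p' x)}].

Lemma sqr_integrable_itv p i : mfun p ->
  muO.-integrable setT (EFin \o (fun x => p x ^+ 2)) -> mu.-integrable (I i) (EFin \o p).
Proof. by move=> mp p2; apply: muO_integrable => //; exact: integrable_muO. Qed.

Lemma rmaxd_ends p (p' : R -> R) i : rmaxd p p' ->
  [/\ cvg (p x @[x --> (alpha i)^'+]), cvg (p x @[x --> (beta i)^'-]) &
      {in I i, continuous p}].
Proof.
move=> [mp mp' p2 p'2 /(_ i)[ac dp]].
by have [] := racont_ends (alpha_lt_beta i) ac (sqr_integrable_itv i mp' p'2) dp.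
Qed.

Lemma rmaxd_by_parts p (p' : R -> R) q (q' : R -> R) : rmaxd p p' -> rmaxd q q' ->
  \int[muO]_x (p' x * q x) + \int[muO]_x (p x * q' x) =
  \sum_(i < n) (lim (p x @[x --> (beta i)^'-]) * lim (q x @[x --> (beta i)^'-]) -
                lim (p x @[x --> (alpha i)^'+]) * lim (q x @[x --> (alpha i)^'+])).
Proof.
move=> [mp mp' p2 p'2 dp] [mq mq' q2 q'2 dq].
have ms (f g : R -> R) : mfun f -> mfun g -> mfun (fun x => f x * g x).
  by move=> mf mg; exact: measurable_funM.
rewrite !Rintegral_muO//; [|exact: ms|exact: sqr_integrableM|exact: ms|exact: sqr_integrableM].
rewrite -big_split/=; apply: eq_bigr => i _.
have [acp dpi] := dp i; have [acq dqi] := dq i.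
exact: (racont_by_parts (alpha_lt_beta i) acp acq (sqr_integrable_itv i mp' p'2)
  (sqr_integrable_itv i mq' q'2) dpi dqi).
Qed.

Lemma sqr_integrable_comb (c : R) p q : mfun p -> mfun q ->
  muO.-integrable setT (EFin \o (fun x => p x ^+ 2)) ->
  muO.-integrable setT (EFin \o (fun x => q x ^+ 2)) ->
  muO.-integrable setT (EFin \o (fun x => (p x + c * q x) ^+ 2)).
Proof.
move=> mp mq ip iq.
rewrite (_ : (fun x => _) = (fun x => p x ^+ 2 + (2 * c * (p x * q x) + c ^+ 2 * q x ^+ 2))); last first.
  by apply/funext => x; ring.
have ipq := sqr_integrableM mp mq ip iq.
by apply: integrableDR => //; apply: integrableDR => //; exact: integrableZR.
Qed.

Lemma mfun_comb (c : R) p q : mfun p -> mfun q -> mfun (fun x => p x + c * q x).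
Proof.
by move=> mp mq; apply: measurable_funD => //; apply: measurable_funM.
Qed.

Lemma rmaxd_comb (c : R) p (p' : R -> R) q (q' : R -> R) : rmaxd p p' -> rmaxd q q' ->
  rmaxd (fun x => p x + c * q x) (fun x => p' x + c * q' x).
Proof.
move=> [mp mp' p2 p'2 dp] [mq mq' q2 q'2 dq]; split.
- exact: mfun_comb.
- exact: mfun_comb.
- exact: sqr_integrable_comb.
- exact: sqr_integrable_comb.
- move=> i; have [acp dpi] := dp i; have [acq dqi] := dq i; split.
    exact: racont_comb.
  apply: aeS2 dpi dqi => x dpi dqi xi; have {}dpi := dpi xi; have {}dqi := dqi xi.
  exact: (is_deriveD dpi (is_deriveZ c dqi)).
Qed.

Lemma in_Omega i (x : R) : x \in `]alpha i, beta i[ -> Om x.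
Proof. by move=> xi; exists i. Qed.

Lemma near_interval i (x : R) (p q : R -> R) :
  {in `]alpha i, beta i[, p =1 q} -> x \in `]alpha i, beta i[ -> \near x, p x = q x.
Proof.
move=> pq xi; have := @near_in_itvoo R (alpha i) (beta i) x xi.
by apply: filterS => y /pq.
Qed.

Lemma lim_right_interval i (p F : R -> R) : {in `]alpha i, beta i[, p =1 F} ->
  continuous F -> lim (p x @[x --> (alpha i)^'+]) = F (alpha i).
Proof.
move=> pF cF; apply/cvg_lim => //.
apply: cvg_trans (cvg_at_right_filter (cF (alpha i))); apply: near_eq_cvg.
apply: filterS2 (nbhs_right_gt (alpha i)) (nbhs_right_lt (alpha_lt_beta i)) => x ax xb.
by rewrite pF// in_itv/= ax.
Qed.

Lemma lim_left_interval i (p F : R -> R) : {in `]alpha i, beta i[, p =1 F} ->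
  continuous F -> lim (p x @[x --> (beta i)^'-]) = F (beta i).
Proof.
move=> pF cF; apply/cvg_lim => //.
apply: cvg_trans (cvg_at_left_filter (cF (beta i))); apply: near_eq_cvg.
apply: filterS2 (nbhs_left_gt (alpha_lt_beta i)) (nbhs_left_lt (beta i)) => x ax xb.
by rewrite pF// in_itv/= ax.
Qed.

Lemma racont_eq i (p q : R -> R) : {in `]alpha i, beta i[, p =1 q} ->
  racont (I i) p -> racont (I i) q.
Proof.
move=> pq acp e e0; have [d d0 h] := acp e e0; exists d => // m a b abI tr sd.
rewrite (_ : \sum_k _ = \sum_k `|p (b k) - p (a k)|); first exact: h.
apply: eq_bigr => k _; have [ab sub] := abI k.
by rewrite !pq//; apply: sub; rewrite /= in_itv/= ?lexx ?ab.
Qed.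

Definition piecewise (F : 'I_n -> R -> R) (x : R) : R := \sum_(i < n) (F i \_ (I i)) x.

Lemma piecewiseE F i : {in `]alpha i, beta i[, piecewise F =1 F i}.
Proof.
move=> x xi; rewrite /piecewise (bigD1 i)//= patchE mem_set// big1 ?addr0// => j ji.
rewrite patchE; case: ifPn => // /set_mem xj; case/eqP: ji.
apply: (interval_disjoint alpha_lt_beta beta_lt_alpha (x := x)).
  by move: xj; rewrite /= in_itv/= => /andP[/ltW-> /ltW->].
by move: xi; rewrite in_itv/= => /andP[/ltW-> /ltW->].
Qed.

Lemma mfun_piecewise F : (forall i, mfun (F i)) -> mfun (piecewise F).
Proof.
move=> mF; apply: measurable_sum => i.
apply: (measurable_restrictT _ (measurable_itv _)).1.
by apply: measurable_funTS; exact: mF.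
Qed.

Lemma piecewise_bounded F (K : R) : 0 <= K ->
  (forall i, {in `]alpha i, beta i[, forall x, `|F i x| <= K}) ->
  forall x, `|piecewise F x| <= n%:R * K.
Proof.
move=> K0 FK x; rewrite (le_trans (ler_norm_sum _ _ _))//.
rewrite mulr_natl -[X in _ *+ X]card_ord -sumr_const; apply: ler_sum => i _.
by rewrite patchE; case: ifPn => [/set_mem/FK//|_]; rewrite normr0.
Qed.

Lemma rmaxd_affine (a b : 'I_n -> R) :
  rmaxd (piecewise (fun i x => a i + b i * x)) (piecewise (fun i _ => b i)).
Proof.
have cA i : continuous (fun x : R => a i + b i * x).
  by move=> x; apply: cvgD; [exact: cvg_cst|apply: cvgM; [exact: cvg_cst|exact: cvg_id]].
have m1 : mfun (piecewise (fun i x => a i + b i * x)).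
  by apply: mfun_piecewise => i; exact: continuous_measurable_fun.
have m2 : mfun (piecewise (fun i _ => b i)).
  by apply: mfun_piecewise => i; exact: measurable_cst.
(* One constant dominating both the affine pieces and their slopes, on every interval. *)
pose K := \sum_(i < n) (`|a i| + `|b i| * (`|alpha i| + `|beta i|)) + \sum_(i < n) `|b i|.
have K0 : 0 <= K.
  by rewrite addr_ge0// sumr_ge0// => i _; rewrite addr_ge0// mulr_ge0// addr_ge0.
split => //.
- apply: (bounded_sqr_integrable alpha_lt_beta beta_lt_alpha (K := n%:R * K)) => //.
  apply: piecewise_bounded => // i x; rewrite in_itv/= => /andP[ax xb].
  have xab : `|x| <= `|alpha i| + `|beta i|.
    have := ler_norm (beta i); have := ler_norm (- alpha i); rewrite normrN.
    have := normr_ge0 (beta i); have := normr_ge0 (alpha i).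
    by move=> *; rewrite ler_norml; apply/andP; split; lra.
  rewrite (le_trans (ler_normD _ _))// normrM.
  rewrite (@le_trans _ _ (\sum_(i < n) (`|a i| + `|b i| * (`|alpha i| + `|beta i|))))//.
    rewrite (bigD1 i)//= -[leLHS]addr0 lerD//.
      by rewrite lerD2l ler_wpM2l.
    by rewrite sumr_ge0// => j _; rewrite addr_ge0// mulr_ge0// addr_ge0.
  by rewrite /K lerDl sumr_ge0.
- apply: (bounded_sqr_integrable alpha_lt_beta beta_lt_alpha (K := n%:R * K)) => //.
  apply: piecewise_bounded => // i x _.
  rewrite /K (bigD1 (P := predT) (F := fun i => `|b i|) i)//= addrCA lerDl addr_ge0//.
    by rewrite sumr_ge0// => j _; rewrite addr_ge0// mulr_ge0// addr_ge0.
  by rewrite sumr_ge0.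
- move=> i; split.
    apply: (@racont_eq i (fun x => a i + b i * x)).
      by move=> x xi; rewrite (piecewiseE _ xi).
    apply: (@lipschitz_racont _ _ _ `|b i|) => x y _ _.
    by rewrite (_ : _ - _ = b i * (x - y)) ?normrM//; ring.
  apply: aeW => x xi; rewrite (piecewiseE _ xi).
  have nx : \near x, a i + b i * x = piecewise (fun i x => a i + b i * x) x.
    by apply: near_interval xi => y yi; rewrite (piecewiseE _ yi).
  apply: near_eq_is_derive nx _.
  by apply: is_derive_eq; rewrite add0r /GRing.scale/= !(mulr1, mul1r).
Qed.

Lemma rmaxd_affine_ends (a b : 'I_n -> R) i : let p := piecewise (fun i x => a i + b i * x) in
  lim (p x @[x --> (alpha i)^'+]) = a i + b i * alpha i /\
  lim (p x @[x --> (beta i)^'-]) = a i + b i * beta i.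
Proof.
have cA : continuous (fun x : R => a i + b i * x).
  by move=> x; apply: cvgD; [exact: cvg_cst|apply: cvgM; [exact: cvg_cst|exact: cvg_id]].
split.
- by rewrite (lim_right_interval (F := fun x => a i + b i * x))//; exact: piecewiseE.
- by rewrite (lim_left_interval (F := fun x => a i + b i * x))//; exact: piecewiseE.
Qed.

(** Linear interpolation on each interval realises any prescribed boundary values. *)
Lemma rmaxd_ends_surj (a b : 'I_n -> R) : exists p p', rmaxd p p' /\
  forall i, lim (p x @[x --> (alpha i)^'+]) = a i /\ lim (p x @[x --> (beta i)^'-]) = b i.
Proof.
pose s i := (b i - a i) / (beta i - alpha i).
exists (piecewise (fun i x => (a i - s i * alpha i) + s i * x)), (piecewise (fun i _ => s i)).
split; first exact: rmaxd_affine.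
move=> i; have [-> ->] := rmaxd_affine_ends (fun i => a i - s i * alpha i) s i.
split; first by rewrite subrK.
rewrite (_ : _ + _ = a i + s i * (beta i - alpha i)); last by ring.
by rewrite /s divfK ?subrKC// subr_eq0 gt_eqF.
Qed.

(** Cutting [g] off outside Omega makes it integrable on the line, so a single primitive works on
    all the intervals. *)
Lemma rmaxd_prim (g : R -> R) : mfun g ->
  muO.-integrable setT (EFin \o (fun x => g x ^+ 2)) -> rmaxd (prim (g \_ Om)) g.
Proof.
move=> mg g2.
have ig : mu.-integrable setT (EFin \o (g \_ Om)).
  apply: integrable_patch; first exact: measurable_Omega.
  apply: (integrable_mrestr mu (measurable_Omega alpha beta) mg).1.
  exact: (integrable_muO alpha_lt_beta beta_lt_alpha mg g2).
have mp : mfun (prim (g \_ Om)).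
  by apply: continuous_measurable_fun; exact: prim_continuous.
split => //.
- by apply: (bounded_sqr_integrable _ _ mp (prim_bounded ig)).
- move=> i; split.
    by apply: racontS (prim_racont ig).
  apply: aeS (prim_derive ig) => x + xi.
  by rewrite patchE mem_set//; exact: in_Omega xi.
Qed.

Lemma rmaxd_lipschitz (v g : R -> R) (L K : R) :
  (forall x, `|v x| <= K) -> (forall x y, `|v x - v y| <= L * `|x - y|) ->
  mfun g -> (forall x, `|g x| <= L) ->
  {ae mu, forall x : R, is_derive x 1 v (g x)} -> rmaxd v g.
Proof.
move=> vK vL mg gL dv.
have L0 : 0 <= L by rewrite (le_trans _ (gL 0)).
have mv : mfun v.
  apply: continuous_measurable_fun => x; apply/cvgrPdist_lt => r r0.
  have L1 : 0 < L + 1 by rewrite ltr_wpDl.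
  exists (r / (L + 1)); first by rewrite /= divr_gt0.
  move=> y /=; rewrite ltr_pdivlMr// => xy.
  rewrite (le_lt_trans (vL _ _))//.
  by rewrite (le_lt_trans _ xy)// mulrC ler_wpM2l// lerDl.
split => //.
- exact: (bounded_sqr_integrable _ _ mv vK).
- exact: (bounded_sqr_integrable _ _ mg gL).
- move=> i; split; first by apply: (@lipschitz_racont _ _ _ L) => x y _ _.
  by apply: aeS dv.
Qed.

Lemma near0_ends p (c : R) : (\near c, p c = 0) ->
  lim (p x @[x --> c^'+]) = 0 /\ lim (p x @[x --> c^'-]) = 0.
Proof.
move=> p0.
have p0' : p x @[x --> c] --> (0 : R) by exact: cvg_near_cst.
split; apply/cvg_lim => //; [exact: cvg_at_right_filter|exact: cvg_at_left_filter].
Qed.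

Lemma alpha_notin_Omega i : ~ Om (alpha i).
Proof.
move=> [j _]; rewrite /= in_itv/= => /andP[h1 h2].
have ij : i = j.
  apply: (interval_disjoint alpha_lt_beta beta_lt_alpha (x := alpha i)).
    by rewrite lexx (ltW (alpha_lt_beta i)).
  by rewrite (ltW h1) (ltW h2).
by move: h1; rewrite -ij ltxx.
Qed.

Lemma beta_notin_Omega i : ~ Om (beta i).
Proof.
move=> [j _]; rewrite /= in_itv/= => /andP[h1 h2].
have ij : i = j.
  apply: (interval_disjoint alpha_lt_beta beta_lt_alpha (x := beta i)).
    by rewrite lexx (ltW (alpha_lt_beta i)).
  by rewrite (ltW h1) (ltW h2).
by move: h2; rewrite -ij ltxx.
Qed.

Section compact_support.
Variables (p p' : R -> R) (K : set R).
Hypothesis dp : forall x : R, is_derive x 1 p (p' x).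
Hypothesis cp' : continuous p'.
Hypothesis cK : compact K.
Hypothesis KO : K `<=` Om.
Hypothesis p0 : forall x, ~ K x -> p x = 0.

Let oK : open (~` K).
Proof. by apply: closed_openC; apply: compact_closed. Qed.

Lemma near_notin_support x : ~ K x -> \near x, p x = 0.
Proof. by move=> Kx; have := oK Kx; apply: filterS => y; exact: p0. Qed.

Lemma derive_support x : ~ K x -> p' x = 0.
Proof.
move=> Kx; have [_ <-] := dp x.
have nx : \near x, cst 0 x = p x by apply: filterS (near_notin_support Kx) => y ->.
by have [_] := near_eq_is_derive nx (is_derive_cst (0 : R) x (1 : R)).
Qed.

Lemma continuous_support_bounded q : continuous q -> (forall x, ~ K x -> q x = 0) ->
  exists M : R, forall x, `|q x| <= M.
Proof.
move=> cq q0.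
have /compact_bounded[M [Mr qM]] := continuous_compact (continuous_subspaceT cq) cK.
exists (`|M| + 1) => x; have [Kx|/q0->] := pselect (K x).
  apply: (qM (`|M| + 1)); last by exists x.
  by rewrite (le_lt_trans (ler_norm _))// ltrDl.
by rewrite normr0 addr_ge0.
Qed.

(** The derivative is continuous with compact support, hence bounded, and the mean value theorem
    makes [p] Lipschitz. The endpoints lie outside the closed set [K], so [p] is 0 near them. *)
Lemma rmaxd_compact_support : rmaxd p p' /\
  forall i, lim (p x @[x --> (alpha i)^'+]) = 0 /\ lim (p x @[x --> (beta i)^'-]) = 0.
Proof.
have cp : continuous p.
  move=> x; apply/differentiable_continuous/derivable1_diffP.
  by case: (dp x).
have [M pM] := continuous_support_bounded cp p0.
have [L p'L] := continuous_support_bounded cp' derive_support.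
split.
  apply: (@rmaxd_lipschitz p p' L M) => //; last exact: aeW.
    move=> x y; wlog yx : x y / y <= x.
      move=> h; have [|/ltW] := leP y x; first exact: h.
      by move=> /h; rewrite distrC (distrC x).
    have [|c _ ->] := @MVT_segment R p p' y x yx.
    - exact: continuous_subspaceT.
    - by rewrite normrM ler_wpM2r.
  exact: continuous_measurable_fun.
move=> i; split.
- apply: (near0_ends (near_notin_support _)).1 => /KO; exact: alpha_notin_Omega.
- apply: (near0_ends (near_notin_support _)).2 => /KO; exact: beta_notin_Omega.
Qed.

End compact_support.

(* Subtracting the primitive [W] of [G] from [U] leaves a function orthogonal to
   the derivatives of all test functions, hence constant on each interval. *)
Lemma rmaxd_weak_derivative (U G : R -> R) : mfun U -> mfun G ->
  muO.-integrable setT (EFin \o (fun x => U x ^+ 2)) ->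
  muO.-integrable setT (EFin \o (fun x => G x ^+ 2)) ->
  (forall (phi : R -> R) i (a b : R), rsmooth phi -> alpha i < a -> b < beta i ->
    (forall x, ~~ (a <= x <= b) -> phi x = 0) ->
    \int[muO]_x (phi^`()%classic x * U x) + \int[muO]_x (phi x * G x) = 0) ->
  exists p, rmaxd p G /\ {ae muO, forall x, U x = p x}.
Proof.
move=> mU mG U2 G2 weak.
pose W := prim (G \_ Om).
have WG : rmaxd W G by exact: rmaxd_prim.
have [mW _ W2 _ _] := WG.
pose Z x := U x + (- 1) * W x.
have mZ : mfun Z by exact: mfun_comb.
have Z2 : muO.-integrable setT (EFin \o (fun x => Z x ^+ 2)) by exact: sqr_integrable_comb.
have cst_on i : exists k, {ae mu, forall x : R, x \in `]alpha i, beta i[ -> Z x = k}.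
  apply: (du_bois_reymond (alpha_lt_beta i)).
    exact: sqr_integrable_itv.
  move=> phi a b sphi aa bb phi0.
  have dphi (x : R) : is_derive x 1 phi (phi^`()%classic x).
    by apply: derivable_is_derive; exact: rsmooth_derivable.
  have cphi' : continuous phi^`()%classic.
    move=> x; apply/differentiable_continuous/derivable1_diffP.
    by apply: rsmooth_derivable; exact: rsmooth_derive.
  have abO : `[a, b]%classic `<=` Om.
    move=> x; rewrite /= in_itv/= => /andP[ax xb]; exists i => //=.
    by rewrite in_itv/= (lt_le_trans aa ax) (le_lt_trans xb bb).
  have phi0' x : ~ `[a, b]%classic x -> phi x = 0.
    by rewrite /= in_itv/= => /negP; exact: phi0.
  have [Dphi ends] := rmaxd_compact_support dphi cphi' (@segment_compact R a b) abO phi0'.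
  have [mphi mphi' phi2 phi'2 _] := Dphi.
  have E1 := weak phi i a b sphi aa bb phi0.
  have E2 := rmaxd_by_parts Dphi WG.
  rewrite big1 in E2; last first.
    by move=> j _; have [-> ->] := ends j; rewrite !mul0r subrr.
  have E3 : \int[muO]_x (phi^`()%classic x * Z x) =
      \int[muO]_x (phi^`()%classic x * U x) - \int[muO]_x (phi^`()%classic x * W x).
    rewrite -RintegralB//; [|exact: sqr_integrableM|exact: sqr_integrableM].
    by apply: eq_Rintegral => x _; rewrite /Z; ring.
  (* [E1] and [E2] share the integral of [phi] times [G], so [U] and [W] have the same integral
     against the derivative of [phi]. *)
  have E4 : \int[muO]_x (phi^`()%classic x * Z x) = 0.
    rewrite E3; apply/eqP; rewrite subr_eq0; apply/eqP.
    exact: (addIr _ (etrans E1 (esym E2))).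
  (* Only interval [i] contributes to the integral over Omega, since [phi] is supported inside
     it. *)
  rewrite -E4 Rintegral_muO//; [|exact: measurable_funM|exact: sqr_integrableM].
  rewrite (bigD1 i)//= big1 ?addr0// => j ji.
  rewrite (@eq_Rintegral _ _ _ mu _ (cst 0)) ?Rintegral_cst ?mul0r//.
  move=> x; rewrite inE => xj.
  rewrite (derive_support dphi (@segment_compact R a b) phi0') ?mul0r//.
  rewrite /= in_itv/= => /andP[ax xb]; case/eqP: ji.
  apply: (interval_disjoint alpha_lt_beta beta_lt_alpha (x := x)).
    by move: xj; rewrite /= in_itv/= => /andP[/ltW-> /ltW->].
  by rewrite (ltW (lt_le_trans aa ax)) (ltW (le_lt_trans xb bb)).
have [k hk] := choice cst_on.
(* The locally constant function with values [k i], written with slope 0 so that [rmaxd_affine]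
   applies. *)
pose S := piecewise (fun i x => k i + 0 * x).
have DS : rmaxd S (piecewise (fun i _ => 0)) by exact: rmaxd_affine.
exists (fun x => W x + 1 * S x); split.
  have := rmaxd_comb 1 WG DS; congr rmaxd; apply/funext => x.
  rewrite [X in _ * X](_ : _ = 0) ?mulr0 ?addr0//.
  by rewrite /piecewise big1// => i _; rewrite patchE; case: ifP.
apply/ae_mrestr.
have : {ae mu, forall x : R, forall i, x \in `]alpha i, beta i[ -> Z x = k i}.
  exact: ae_forall_ord.
apply: aeS => x h [i _ xi]; rewrite /S (piecewiseE _ xi) mul0r addr0 mul1r -(h i xi) /Z.
by ring.
Qed.

End maximal_domain.

(** * Independence of the absolutely continuous representative *)

Section uniqueness.
Context {R : realType} (n : nat) (alpha beta : 'I_n -> R).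
Hypothesis alpha_lt_beta : forall i : 'I_n, alpha i < beta i.
Hypothesis beta_lt_alpha : forall i j : 'I_n, j = i.+1 :> nat -> beta i < alpha j.
Notation mu := (@lebesgue_measure R).
Local Notation Om := (Omega alpha beta).
Local Notation muO := (mu_Omega alpha beta).
Local Notation I i := (`]alpha i, beta i[%classic : set (measurableTypeR R)).

Lemma ae_interval_exists (a b : R) (P : R -> Prop) : a < b ->
  {ae mu, forall x, P x} -> exists2 x, x \in `]a, b[ & P x.
Proof.
move=> ab [N [mN N0 sN]]; apply: contrapT => nex.
have sub : (`]a, b[%classic : set (measurableTypeR R)) `<=` N.
  by move=> x xi; apply: sN => /= Px; apply: nex; exists x.
have : (mu `]a, b[ <= mu N)%E.
  by apply: le_measure; rewrite ?inE//; exact: measurable_itv.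
by rewrite [X in (_ <= X)%E]N0 lebesgue_measure_itv/= lte_fin ab -EFinB lee_fin leNgt subr_gt0 ab.
Qed.

(** By continuity a nonzero value would persist on a whole interval, which has positive measure. *)
Lemma ae_eq0_continuous i (d : R -> R) : {in I i, continuous d} ->
  {ae muO, forall x, d x = 0} -> {in `]alpha i, beta i[, forall x, d x = 0}.
Proof.
move=> cd /ae_mrestr d0 x xi; apply: contrapT => /eqP dx0.
have xI : x \in I i by rewrite inE.
have dn : \near x, d x != 0 by exact: (cvgr_neq0 _ (cd x xI) dx0).
have [r /= r0 hr] := filterI (@near_in_itvoo R _ _ _ xi) dn.
have [|y yi /= dy] := @ae_interval_exists (x - r) (x + r) _ _ d0; first by lra.
have [|yi' /eqP] := hr y.
  by move: yi; rewrite in_itv/= /ball/= ltr_distl; lra.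
by apply; apply: dy; exists i.
Qed.

(** Representatives that agree almost everywhere agree at every point of Omega by continuity. This
    makes the derivative class and the boundary values functions of the L^2 class. *)
Lemma rmaxd_unique (p p' q q' : R -> R) : rmaxd alpha beta p p' -> rmaxd alpha beta q q' ->
  {ae muO, forall x, p x = q x} ->
  {ae muO, forall x, p' x = q' x} /\
  forall i, lim (p x @[x --> (alpha i)^'+]) = lim (q x @[x --> (alpha i)^'+]) /\
    lim (p x @[x --> (beta i)^'-]) = lim (q x @[x --> (beta i)^'-]).
Proof.
move=> Dp Dq pq.
have Dd := rmaxd_comb (-1) Dp Dq.
have eq_pq i : {in `]alpha i, beta i[, p =1 q}.
  have [_ _ cd] := rmaxd_ends alpha_lt_beta beta_lt_alpha i Dd.
  have d0 : {ae muO, forall x, p x + -1 * q x = 0}.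
    by apply: aeS pq => x ->; rewrite mulN1r subrr.
  by move=> x /(ae_eq0_continuous cd d0)/eqP; rewrite mulN1r subr_eq0 => /eqP.
split.
- apply/ae_mrestr.
  have [_ _ _ _ dp] := Dp; have [_ _ _ _ dq] := Dq.
  have h1 := ae_forall_ord (fun i => (dp i).2); have h2 := ae_forall_ord (fun i => (dq i).2).
  apply: aeS2 h1 h2 => x h1 h2 [i _ xi].
  have [_ <-] := h1 i xi; have dqx := h2 i xi.
  have nx : \near x, q x = p x.
    by apply: near_interval xi => y /eq_pq ->.
  by have [_ ->] := near_eq_is_derive nx dqx.
- move=> i; have [ca cb _] := rmaxd_ends alpha_lt_beta beta_lt_alpha i Dq.
  split; apply: (cvg_lim (@Rhausdorff R)).
  + apply: cvg_trans ca; apply: near_eq_cvg.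
    apply: filterS2 (nbhs_right_gt (alpha i)) (nbhs_right_lt (alpha_lt_beta i)) => x ax xb.
    by rewrite (eq_pq i)// in_itv/= ax.
  + apply: cvg_trans cb; apply: near_eq_cvg.
    apply: filterS2 (nbhs_left_gt (alpha_lt_beta i)) (nbhs_left_lt (beta i)) => x ax xb.
    by rewrite (eq_pq i)// in_itv/= ax.
Qed.

End uniqueness.

(** * Passage from complex to real functions *)

Section complex_functions.
Context {R : realType}.
Local Notation C := R[i].
Local Notation Re := complex.Re.
Local Notation Im := complex.Im.

Lemma normr_Re_le (z : C) : `|Re z| <= Normc.normc z.
Proof. by case: z => a b /=; rewrite -sqrtr_sqr ler_wsqrtr// lerDl sqr_ge0. Qed.

Lemma normr_Im_le (z : C) : `|Im z| <= Normc.normc z.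
Proof. by case: z => a b /=; rewrite -sqrtr_sqr ler_wsqrtr// lerDr sqr_ge0. Qed.

Lemma normc_le (z : C) : Normc.normc z <= `|Re z| + `|Im z|.
Proof.
have h0 : 0 <= `|Re z| + `|Im z| by rewrite addr_ge0.
rewrite -(ger0_norm h0) -sqrtr_sqr; case: z h0 => a b /= _.
rewrite ler_wsqrtr// -(real_normK (num_real a)) -(real_normK (num_real b)).
by have := mulr_ge0 (normr_ge0 a) (normr_ge0 b); nra.
Qed.

Lemma abs_contE (I : set R) (f : R -> C) : abs_cont I f <->
  racont I (fun x => Re (f x)) /\ racont I (fun x => Im (f x)).
Proof.
have ReB (z w : C) : Re (z - w) = Re z - Re w by case: z w => ? ? [].
have ImB (z w : C) : Im (z - w) = Im z - Im w by case: z w => ? ? [].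
split=> [acf|[acr aci] e e0].
  split=> e e0; have [d d0 h] := acf e e0; exists d => // m a b abI tr sd.
    apply: le_lt_trans (h m a b abI tr sd); apply: ler_sum => k _.
    by rewrite -ReB normr_Re_le.
  apply: le_lt_trans (h m a b abI tr sd); apply: ler_sum => k _.
  by rewrite -ImB normr_Im_le.
have e20 : 0 < e / 2 by rewrite divr_gt0.
have [d1 d10 h1] := acr _ e20; have [d2 d20 h2] := aci _ e20.
exists (Num.min d1 d2); first by rewrite lt_min d10.
move=> m a b abI tr; rewrite lt_min => /andP[/(h1 m a b abI tr) {}h1].
move=> /(h2 m a b abI tr) {}h2.
rewrite [ltRHS](splitr e); apply: le_lt_trans (ltrD h1 h2).
rewrite -big_split/=; apply: ler_sum => k _.
by rewrite -ReB -ImB normc_le.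
Qed.

Lemma inv_2ipi_neq0 : inv_2ipi R != 0.
Proof.
by rewrite /inv_2ipi invr_eq0 eq_complex /= eqxx/= mulf_neq0// gt_eqF// pi_gt0.
Qed.

Lemma conj_inv_2ipi : conjc (inv_2ipi R) = - inv_2ipi R.
Proof.
rewrite /inv_2ipi fmorphV/= -invrN; congr (_^-1).
by apply/eqP; rewrite eq_complex/= oppr0 !eqxx.
Qed.

End complex_functions.

(** * Boundary values and self-adjoint extensions *)

Section isotropic_relations.
Context {C : numClosedFieldType} (n : nat).
Implicit Types (a b : 'cV[C]_n).

(** Conjugate-linear in the second argument, like [L2dot]. *)
Definition cdot a b : C := \sum_(i < n) a i 0 * (b i 0)^*.

Lemma cdot_lin (c : C) a b a1 : cdot (c *: a + a1) b = c * cdot a b + cdot a1 b.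
Proof.
rewrite /cdot mulr_sumr -big_split/=; apply: eq_bigr => i _.
by rewrite !mxE mulrDl mulrA.
Qed.

Lemma cdotB a b a1 : cdot (a - a1) b = cdot a b - cdot a1 b.
Proof. by rewrite addrC -scaleN1r cdot_lin mulN1r addrC. Qed.

Lemma cdot_conj a b : cdot b a = (cdot a b)^*.
Proof.
by rewrite /cdot rmorph_sum; apply: eq_bigr => i _; rewrite rmorphM/= conjCK mulrC.
Qed.

Lemma cdotBr b a a1 : cdot b (a - a1) = cdot b a - cdot b a1.
Proof. by rewrite cdot_conj cdotB rmorphB/= -!cdot_conj. Qed.

Lemma cdot_eq0 a : cdot a a = 0 -> a = 0.
Proof.
move=> /eqP; rewrite psumr_eq0; last by move=> i _; exact: mul_conjC_ge0.
move=> /allP h; apply/colP => i; rewrite mxE; apply/eqP.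
by rewrite -mul_conjC_eq0; apply: (h i); rewrite mem_index_enum.
Qed.

Lemma cdotE a b : cdot a b = ((map_mx Num.conj (trmx b)) *m a) 0 0.
Proof. by rewrite mxE; apply: eq_bigr => i _; rewrite !mxE mulrC. Qed.

Lemma cdot_delta (j k : 'I_n) : cdot (delta_mx j 0) (delta_mx k 0) = (j == k)%:R.
Proof.
rewrite /cdot (bigD1 j)//= big1 ?addr0 => [|i ij]; last first.
  by rewrite mxE (negbTE ij)/= mul0r.
by rewrite !mxE !eqxx/= mul1r andbT; case: eqP; rewrite ?conjC0 ?conjC1.
Qed.

Lemma cdot_unitary (B : 'M[C]_n) a b : B \is unitarymx -> cdot (B *m a) (B *m b) = cdot a b.
Proof.
move=> uB; rewrite !cdotE trmx_mul map_mxM -mulmxA; congr ((_ *m _) 0 0).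
by rewrite -invmx_unitary// mulKmx// unitarymx_unit.
Qed.

Lemma cdot_adjoint (B : 'M[C]_n) a b :
  cdot (B *m a) b = cdot a (map_mx Num.conj (trmx B) *m b).
Proof.
rewrite !cdotE trmx_mul map_mxM !mulmxA; congr ((_ *m _ *m _) 0 0).
by apply/matrixP => i j; rewrite !mxE /= conjCK.
Qed.

Lemma mulmx_inj (A B : 'M[C]_n) : (forall a, A *m a = B *m a) -> A = B.
Proof.
move=> AB; apply/matrixP => i j.
have /colP/(_ i) := AB (delta_mx j 0).
by rewrite -!colE !mxE.
Qed.

(* For a matrix of maximal rank with rows in [S], the kernel is orthogonal to
   [S], hence trivial. *)
Lemma subspace_total (S : 'cV[C]_n -> Prop) : S 0 ->
  (forall c a b, S a -> S b -> S (c *: a + b)) ->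
  (forall w, (forall a, S a -> cdot a w = 0) -> w = 0) -> forall a, S a.
Proof.
move=> S0 Slin Sorth.
(* Subspaces of [S] are encoded by square matrices, with rows spanning them: [addsmx] returns a
   square matrix again, and the rank is at most [n], so a maximal one exists. *)
pose P r := `[< exists M : 'M[C]_n, \rank M = r /\ forall i, S (row i M)^T >].
have exP : exists r, P r.
  exists 0%N; apply/asboolP; exists 0; split; first exact: mxrank0.
  by move=> i; rewrite row0 trmx0.
have leP r : P r -> (r <= n)%N by move=> /asboolP[M [<- _]]; exact: rank_leq_row.
case: (ex_maxnP exP leP) => r /asboolP[M [rM SM]] maxr.
have S_sub (M' : 'M[C]_n) (v : 'rV[C]_n) : (forall i, S (row i M')^T) ->
    (v <= M')%MS -> S v^T.
  move=> SM' /submxP[D ->]; rewrite mulmx_sum_row.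
  elim/big_rec: _ => [|i w _ Sw]; first by rewrite trmx0.
  by rewrite linearD linearZ; apply: Slin; [exact: SM'|exact: Sw].
have S_M a : S a -> (a^T <= M)%MS.
  move=> Sa; apply: contrapT => /negP aM.
  have SD i : S (row i (M + a^T)%MS)^T.
    have /sub_addsmxP[[u w] ->] : (row i (M + a^T)%MS <= M + a^T)%MS by exact: row_sub.
    have SuM : S (u *m M)^T by apply: S_sub SM _; exact: submxMl.
    rewrite /= linearD/= addrC (mx11_scalar w) mul_scalar_mx linearZ/= trmxK.
    exact: Slin.
  (* Adjoining a vector outside the row space would raise the rank above the maximum. *)
  have : P (\rank (M + a^T)%MS) by apply/asboolP; exists (M + a^T)%MS.
  move=> /maxr; rewrite leqNgt -rM => /negP; apply.
  have lt : (M < M + a^T)%MS.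
    rewrite ltmxE addsmxSl/=; apply: contra aM => h.
    exact: submx_trans (addsmxSr _ _) h.
  by move: lt; rewrite ltmxErank => /andP[].
have fullM : row_full M.
  rewrite /row_full eqn_leq rank_leq_col/= leqNgt; apply/negP => rkM.
  have : kermx M^T != 0.
    rewrite kermx_eq0 /row_free mxrank_tr; apply/eqP => h.
    by move: rkM; rewrite h ltnn.
  move=> /rowV0Pn[w /sub_kermxP wM w0].
  (* The kernel vector is conjugated because [cdot] conjugates its second argument. *)
  case/eqP: w0; have : map_mx Num.conj w^T = 0.
    apply: Sorth => a /S_M /submxP[D aE].
    rewrite cdotE.
    have -> : map_mx Num.conj (map_mx Num.conj w^T)^T = w.
      by apply/matrixP => i j; rewrite !mxE conjCK.
    by rewrite -(trmxK a) aE trmx_mul mulmxA wM mul0mx mxE.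
  move=> /matrixP wE; apply/rowP => i; have := wE i 0; rewrite !mxE.
  by move=> /eqP; rewrite conjC_eq0 => /eqP.
move=> a; rewrite -(trmxK a); apply: S_sub SM _.
exact: submx_full.
Qed.

(* [W] is its own orthogonal for the indefinite form [cdot b b1 - cdot a a1]. If
   [w] is orthogonal to the domain of [W], then [W w 0], so [w = 0] since [W]
   is isotropic: the domain is everything. *)
Lemma isotropic_unitary (W : 'cV[C]_n -> 'cV[C]_n -> Prop) : W 0 0 ->
  (forall c a b a1 b1, W a b -> W a1 b1 -> W (c *: a + a1) (c *: b + b1)) ->
  (forall a b, W a b <-> forall a1 b1, W a1 b1 -> cdot b1 b = cdot a1 a) ->
  exists2 B : 'M[C]_n, B \is unitarymx & forall a b, W a b <-> b = B *m a.
Proof.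
move=> W0 Wlin Wmax.
have iso a b a1 b1 : W a b -> W a1 b1 -> cdot b b1 = cdot a a1.
  by move=> Wab /Wmax; exact.
have total : forall a, exists b, W a b.
  apply: subspace_total; first by exists 0.
    by move=> c a a1 [b ab] [b1 ab1]; exists (c *: b + b1); exact: Wlin.
  move=> w orth.
  have Ww : W w 0.
    apply/Wmax => a b Wab; rewrite orth; last by exists b.
    by rewrite /cdot big1// => i _; rewrite mxE conjC0 mulr0.
  apply: cdot_eq0; rewrite -(iso _ _ _ _ Ww Ww).
  by rewrite /cdot big1// => i _; rewrite mxE mul0r.
have func a b b1 : W a b -> W a b1 -> b = b1.
  move=> Wab Wab1; apply/eqP; rewrite -subr_eq0; apply/eqP/cdot_eq0.
  (* The difference is paired with 0, so isotropy makes its norm 0. *)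
  have W0b : W 0 (b - b1).
    by have := Wlin (-1) _ _ _ _ Wab1 Wab; rewrite !scaleN1r addNr addrC.
  rewrite (iso _ _ _ _ W0b W0b).
  by rewrite /cdot big1// => i _; rewrite mxE mul0r.
have [e eW] := choice total.
pose B : 'M[C]_n := \matrix_(i, j) e (delta_mx j 0) i 0.
have BE a : B *m a = \sum_(j < n) a j 0 *: e (delta_mx j 0).
  apply/colP => i; rewrite mxE summxE; apply: eq_bigr => j _.
  by rewrite !mxE mulrC.
have WB a : W a (B *m a).
  have aE : a = \sum_(j < n) a j 0 *: delta_mx j 0.
    rewrite [LHS]matrix_sum_delta; apply: eq_bigr => j _.
    by rewrite big_ord1.
  rewrite BE {1}aE; elim/big_rec2: _ => // j x y _ Wxy.
  exact: Wlin.
exists B.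
  (* Isotropy at pairs of basis vectors says that the columns of [B] are orthonormal. *)
  rewrite -trmxC_unitary; apply/unitarymxP; apply/matrixP => k j.
  have := iso _ _ _ _ (WB (delta_mx j 0)) (WB (delta_mx k 0)).
  rewrite cdot_delta -!colE /cdot => E; rewrite !mxE eq_sym -E.
  by apply: eq_bigr => i _; rewrite !mxE conjCK mulrC.
move=> a b; split=> [Wab|->]; last exact: WB.
exact: func (WB a).
Qed.

End isotropic_relations.

(** * The maximal operator, its boundary form and the adjoint *)

Section momentum_operator.
Context {R : realType} (n : nat) (alpha beta : 'I_n -> R).
Hypothesis alpha_lt_beta : forall i : 'I_n, alpha i < beta i.
Hypothesis beta_lt_alpha : forall i j : 'I_n, j = i.+1 :> nat -> beta i < alpha j.
Notation mu := (@lebesgue_measure R).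
Local Notation C := R[i].
Local Notation Re := complex.Re.
Local Notation Im := complex.Im.
Local Notation Om := (Omega alpha beta).
Local Notation muO := (mu_Omega alpha beta).
Local Notation pi f := (\pi_(L2 muO)%qT f : L2 muO).
Local Notation c0 := (inv_2ipi R).
Local Notation va := (val_alpha alpha).
Local Notation vb := (val_beta beta).
Implicit Types (f g h k : L2fun muO) (u v : L2 muO).

(** The derivative is carried as a second function, so that the graph of [D_star] consists of the
    classes of [f] and of [c0] times [g]. *)
Definition maxd f g := (forall i, abs_cont `]alpha i, beta i[%classic f) /\
  {ae muO, forall x, is_cderive f x (g x)}.

Lemma maxdP f g : maxd f g <->
  rmaxd alpha beta (fun x => Re (f x)) (fun x => Re (g x)) /\
  rmaxd alpha beta (fun x => Im (f x)) (fun x => Im (g x)).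
Proof.
split=> [[acf /ae_mrestr df]|[[_ _ _ _ hr] [_ _ _ _ hi]]].
  split; split; do ?[exact: L2fun_Re_measurable|exact: L2fun_Im_measurable|
    exact: L2fun_Re_integrable|exact: L2fun_Im_integrable] => i;
    have [acr aci] := (abs_contE _ _).1 (acf i); split => //;
    by apply: aeS df => x + xi; case=> //; exact: in_Omega xi.
split; first by move=> i; apply/abs_contE; split; [case: (hr i)|case: (hi i)].
apply/ae_mrestr.
have h1 := ae_forall_ord (fun i => (hr i).2); have h2 := ae_forall_ord (fun i => (hi i).2).
by apply: aeS2 h1 h2 => x h1 h2 [i _ xi]; split; [exact: h1 i xi|exact: h2 i xi].
Qed.

Lemma D_maxP f : D_max alpha beta f <-> exists g, maxd f g.
Proof. by split=> [[acf [g df]]|[g [acf df]]]; [exists g|split => //; exists g]. Qed.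

Lemma eq_val f h : (forall i,
    lim (Re (f x) @[x --> (alpha i)^'+]) = lim (Re (h x) @[x --> (alpha i)^'+]) /\
    lim (Re (f x) @[x --> (beta i)^'-]) = lim (Re (h x) @[x --> (beta i)^'-])) ->
  (forall i,
    lim (Im (f x) @[x --> (alpha i)^'+]) = lim (Im (h x) @[x --> (alpha i)^'+]) /\
    lim (Im (f x) @[x --> (beta i)^'-]) = lim (Im (h x) @[x --> (beta i)^'-])) ->
  va f = va h /\ vb f = vb h.
Proof.
move=> hr hi; split; apply/colP => i; rewrite !mxE; congr Complex.
- exact: (hr i).1.
- exact: (hi i).1.
- exact: (hr i).2.
- exact: (hi i).2.
Qed.

Lemma maxd_unique f g h k : maxd f g -> maxd h k -> pi f = pi h ->
  [/\ pi g = pi k, va f = va h & vb f = vb h].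
Proof.
move=> /maxdP[fr fi] /maxdP[hr hi] /eq_L2 fh.
have er : {ae muO, forall x, Re (f x) = Re (h x)} by apply: aeS fh => x ->.
have ei : {ae muO, forall x, Im (f x) = Im (h x)} by apply: aeS fh => x ->.
have [gr lr] := rmaxd_unique alpha_lt_beta beta_lt_alpha fr hr er.
have [gi li] := rmaxd_unique alpha_lt_beta beta_lt_alpha fi hi ei.
have [] := eq_val lr li; split => //; apply/eq_L2.
by apply: aeS2 gr gi => x; case: (g x) (k x) => ? ? [? ?] /= -> ->.
Qed.

Lemma maxd_comb (c : C) f g h k : maxd f g -> maxd h k ->
  [/\ maxd (c *: f + h) (c *: g + k), va (c *: f + h) = c *: va f + va h &
      vb (c *: f + h) = c *: vb f + vb h].
Proof.
move=> /maxdP[fr fi] /maxdP[hr hi].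
have ReE (f1 h1 : L2fun muO) :
    (fun x => Re ((c *: f1 + h1) x)) =
    (fun x => (Re (h1 x) + Re c * Re (f1 x)) + (- Im c) * Im (f1 x)).
  apply/funext => x; rewrite -[(c *: f1 + h1) x]/(c * f1 x + h1 x).
  by case: (c) (f1 x) (h1 x) => ? ? [? ?] [? ?] /=; ring.
have ImE (f1 h1 : L2fun muO) :
    (fun x => Im ((c *: f1 + h1) x)) =
    (fun x => (Im (h1 x) + Re c * Im (f1 x)) + Im c * Re (f1 x)).
  apply/funext => x; rewrite -[(c *: f1 + h1) x]/(c * f1 x + h1 x).
  by case: (c) (f1 x) (h1 x) => ? ? [? ?] [? ?] /=; ring.
have lim_comb (F : set_system R) (FF : ProperFilter F) (a b : R) (p q r : R -> R) :
    cvg (p x @[x --> F]) -> cvg (q x @[x --> F]) -> cvg (r x @[x --> F]) ->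
    lim (p x + a * q x + b * r x @[x --> F]) =
    lim (p x @[x --> F]) + a * lim (q x @[x --> F]) + b * lim (r x @[x --> F]).
  move=> cp cq cr; apply/cvg_lim => //.
  by apply: cvgD; [apply: cvgD => //|]; apply: cvgM => //; exact: cvg_cst.
split.
- apply/maxdP; rewrite !ReE !ImE; split.
    by apply: rmaxd_comb => //; exact: rmaxd_comb.
  by apply: rmaxd_comb => //; exact: rmaxd_comb.
- apply/colP => i; rewrite !mxE /lim_right ReE ImE.
  have [cfr _ _] := rmaxd_ends alpha_lt_beta beta_lt_alpha i fr.
  have [cfi _ _] := rmaxd_ends alpha_lt_beta beta_lt_alpha i fi.
  have [chr _ _] := rmaxd_ends alpha_lt_beta beta_lt_alpha i hr.
  have [chi _ _] := rmaxd_ends alpha_lt_beta beta_lt_alpha i hi.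
  rewrite (lim_comb _ _ _ _ _ _ _ chr cfr cfi) (lim_comb _ _ _ _ _ _ _ chi cfi cfr).
  by case: (c) => a b; apply/eqP; rewrite eq_complex/=; apply/andP; split; apply/eqP; ring.
- apply/colP => i; rewrite !mxE /lim_left ReE ImE.
  have [_ cfr _] := rmaxd_ends alpha_lt_beta beta_lt_alpha i fr.
  have [_ cfi _] := rmaxd_ends alpha_lt_beta beta_lt_alpha i fi.
  have [_ chr _] := rmaxd_ends alpha_lt_beta beta_lt_alpha i hr.
  have [_ chi _] := rmaxd_ends alpha_lt_beta beta_lt_alpha i hi.
  rewrite (lim_comb _ _ _ _ _ _ _ chr cfr cfi) (lim_comb _ _ _ _ _ _ _ chi cfi cfr).
  by case: (c) => a b; apply/eqP; rewrite eq_complex/=; apply/andP; split; apply/eqP; ring.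
Qed.

(** Real integration by parts for the four combinations of real and imaginary parts, regrouped by
    [ReE] and [ImE]. *)
Lemma green f g h k : maxd f g -> maxd h k ->
  L2dot muO (pi g) (pi h) + L2dot muO (pi f) (pi k) =
  cdot (vb f) (vb h) - cdot (va f) (va h).
Proof.
move=> /maxdP[fr fi] /maxdP[hr hi].
have rr := rmaxd_by_parts alpha_lt_beta beta_lt_alpha fr hr.
have ri := rmaxd_by_parts alpha_lt_beta beta_lt_alpha fr hi.
have ir := rmaxd_by_parts alpha_lt_beta beta_lt_alpha fi hr.
have ii := rmaxd_by_parts alpha_lt_beta beta_lt_alpha fi hi.
rewrite !L2dotE -sumrB.
have ReE (a b c d : C) : (Re a * Re b - Re c * Re d) + (Im a * Im b - Im c * Im d) =
    Re (a * conjc b - c * conjc d).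
  by case: a b c d => ? ? [? ?] [? ?] [? ?] /=; ring.
have ImE (a b c d : C) : (Im a * Re b - Im c * Re d) - (Re a * Im b - Re c * Im d) =
    Im (a * conjc b - c * conjc d).
  by case: a b c d => ? ? [? ?] [? ?] [? ?] /=; ring.
apply/eqP; rewrite eq_complex/=; apply/andP; split; apply/eqP.
- rewrite addrACA; apply: etrans (f_equal2 (fun x y => x + y) rr ii) _.
  rewrite -big_split/= raddf_sum/=; apply: eq_bigr => i _; rewrite !mxE.
  exact: (ReE (lim_left f (beta i)) (lim_left h (beta i))
              (lim_right f (alpha i)) (lim_right h (alpha i))).
- rewrite addrACA -opprD; apply: etrans (f_equal2 (fun x y => x - y) ir ri) _.
  rewrite -sumrB/= raddf_sum/=; apply: eq_bigr => i _; rewrite !mxE.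
  exact: (ImE (lim_left f (beta i)) (lim_left h (beta i))
              (lim_right f (alpha i)) (lim_right h (alpha i))).
Qed.

Lemma L2fun_of_rmaxd (p p' q q' : R -> R) : rmaxd alpha beta p p' -> rmaxd alpha beta q q' ->
  exists f g, [/\ maxd f g, L2val f = fun x => Complex (p x) (q x) &
    L2val g = fun x => Complex (p' x) (q' x)].
Proof.
move=> Dp Dq; have [mp mp' p2 p'2 _] := Dp; have [mq mq' q2 q'2 _] := Dq.
have [f fE] := L2fun_of mp mq p2 q2; have [g gE] := L2fun_of mp' mq' p'2 q'2.
by exists f, g; split => //; apply/maxdP; rewrite fE gE.
Qed.

Lemma val_surj (a b : 'cV[C]_n) : exists f g, [/\ maxd f g, va f = a & vb f = b].
Proof.
have [p [p' [Dp pE]]] := rmaxd_ends_surj alpha_lt_beta beta_lt_alpha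
  (fun i => Re (a i 0)) (fun i => Re (b i 0)).
have [q [q' [Dq qE]]] := rmaxd_ends_surj alpha_lt_beta beta_lt_alpha
  (fun i => Im (a i 0)) (fun i => Im (b i 0)).
have [f [g [fg fE _]]] := L2fun_of_rmaxd Dp Dq.
exists f, g; split => //; apply/colP => i; rewrite !mxE fE /lim_right /lim_left/=.
- by rewrite (pE i).1 (qE i).1; case: (a i 0).
- by rewrite (pE i).2 (qE i).2; case: (b i 0).
Qed.

Lemma test_maxd f g : test_function Om f -> (forall x, is_cderive f x (g x)) ->
  [/\ maxd f g, va f = 0 & vb f = 0].
Proof.
move=> [sf cK KO] df.
have f0 x : ~ closure [set x | L2val f x != 0] x -> f x = 0.
  by move=> Kx; apply/eqP; apply: contrapT => /negP fx; apply: Kx; exact: subset_closure.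
have dr (x : R) : is_derive x 1 (fun t => Re (f t)) (Re (g x)) by case: (df x).
have di (x : R) : is_derive x 1 (fun t => Im (f t)) (Im (g x)) by case: (df x).
have cr : continuous (fun x => Re (g x)).
  move=> x; apply/differentiable_continuous/derivable1_diffP.
  by rewrite -(derive1_is_derive dr); exact: (sf 1%N x).1.
have ci : continuous (fun x => Im (g x)).
  move=> x; apply/differentiable_continuous/derivable1_diffP.
  by rewrite -(derive1_is_derive di); exact: (sf 1%N x).2.
have fr0 x : ~ closure [set x | L2val f x != 0] x -> Re (f x) = 0 by move=> /f0 ->.
have fi0 x : ~ closure [set x | L2val f x != 0] x -> Im (f x) = 0 by move=> /f0 ->.
have [Dr lr] := rmaxd_compact_support alpha_lt_beta beta_lt_alpha dr cr cK KO fr0.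
have [Di li] := rmaxd_compact_support alpha_lt_beta beta_lt_alpha di ci cK KO fi0.
split; first by apply/maxdP.
- by apply/colP => i; rewrite !mxE /lim_right (lr i).1 (li i).1.
- by apply/colP => i; rewrite !mxE /lim_left (lr i).2 (li i).2.
Qed.

Lemma D_op_maxd u v : D_op alpha beta (u, v) ->
  exists f g, [/\ maxd f g, va f = 0, vb f = 0, u = pi f & v = c0 *: pi g].
Proof.
move=> [f [g [tf df [-> ->]]]]; have [? ? ?] := test_maxd tf df.
by exists f, g.
Qed.

Lemma D_op_real (phi : R -> R) i (a b : R) : rsmooth phi -> alpha i < a -> b < beta i ->
  (forall x, ~~ (a <= x <= b) -> phi x = 0) ->
  exists f g, [/\ D_op alpha beta (pi f, c0 *: pi g),
    L2val f = (fun x => Complex (phi x) 0) &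
    L2val g = (fun x => Complex (phi^`()%classic x) 0)].
Proof.
move=> sphi aa bb phi0.
have dphi (x : R) : is_derive x 1 phi (phi^`()%classic x).
  by apply: derivable_is_derive; exact: rsmooth_derivable.
have cphi' : continuous phi^`()%classic.
  move=> x; apply/differentiable_continuous/derivable1_diffP.
  by apply: rsmooth_derivable; exact: rsmooth_derive.
have abO : `[a, b]%classic `<=` Om.
  move=> x; rewrite /= in_itv/= => /andP[ax xb]; exists i => //=.
  by rewrite in_itv/= (lt_le_trans aa ax) (le_lt_trans xb bb).
have phi0' x : ~ `[a, b]%classic x -> phi x = 0.
  by rewrite /= in_itv/= => /negP; exact: phi0.
have [Dphi _] := rmaxd_compact_support alpha_lt_beta beta_lt_alpha dphi cphi'
  (@segment_compact R a b) abO phi0'.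
(* The difference of [Dphi] with itself supplies the zero imaginary part and its derivative. *)
have [f [g [fg fE gE]]] := L2fun_of_rmaxd Dphi
  (rmaxd_comb (-1) Dphi Dphi).
have E0 (p : R -> R) : (fun x => Complex (p x) (p x + -1 * p x)) = fun x => Complex (p x) 0.
  by apply/funext => x; rewrite mulN1r subrr.
rewrite E0 in fE; rewrite E0 in gE.
exists f, g; split => //; exists f, g; split => //.
- have Kab : closure [set x | L2val f x != 0] `<=` `[a, b]%classic.
    rewrite closureE; apply: smallest_sub; first exact: itv_closed.
    move=> x /=; rewrite fE; apply: contraNP => /phi0' ->.
    by apply/eqP.
  split.
  + move=> k x; rewrite fE /=; split; first exact: sphi.
    exact: (@rsmooth_cst R 0 k x).
  + apply: (subclosed_compact _ (@segment_compact R a b)) => //.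
    exact: closed_closure.
  + exact: subset_trans abO.
- move=> x; rewrite fE gE; split => /=; first exact: dphi.
  exact: is_derive_cst.
Qed.

(** From right to left, test functions have zero boundary values and the right side of [green]
    vanishes. From left to right, orthogonality to the test functions says that [V] is the weak
    derivative of [U], and [rmaxd_weak_derivative] applies to each component. *)
Lemma D_star_maxd u v : D_star alpha beta (u, v) <->
  exists f g, [/\ maxd f g, u = pi f & v = c0 *: pi g].
Proof.
split; last first.
  move=> [f [g [fg -> ->]]] [u' v'] /D_op_maxd[h [k [hk ah bh -> ->]]] /=.
  rewrite L2dotZl L2dotZr conj_inv_2ipi mulNr; apply/eqP; rewrite -addr_eq0 -mulrDr.
  rewrite (green hk fg) ah bh /cdot !big1 ?subrr ?mulr0//.
  - by move=> i _; rewrite mxE mul0r.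
  - by move=> i _; rewrite mxE mul0r.
move=> Duv.
have [U uE] : exists U, u = pi U by exists (repr u); rewrite reprK.
(* Every [v] has this form because [c0] is invertible. *)
have [V vE] : exists V, v = c0 *: pi V.
  exists (c0^-1 *: repr v).
  by rewrite -piZ scalerA divff ?inv_2ipi_neq0// scale1r reprK.
have weak (phi : R -> R) i (a b : R) : rsmooth phi -> alpha i < a -> b < beta i ->
    (forall x, ~~ (a <= x <= b) -> phi x = 0) ->
    \int[muO]_x (phi^`()%classic x * Re (U x)) + \int[muO]_x (phi x * Re (V x)) = 0 /\
    \int[muO]_x (phi^`()%classic x * Im (U x)) + \int[muO]_x (phi x * Im (V x)) = 0.
  move=> sphi aa bb phi0.
  have [f [g [fg fE gE]]] := D_op_real sphi aa bb phi0.
  have := Duv _ fg; rewrite /= uE vE L2dotZl L2dotZr conj_inv_2ipi mulNr.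
  move=> /eqP; rewrite -addr_eq0 -mulrDr mulf_eq0 (negbTE inv_2ipi_neq0)/= => /eqP.
  rewrite !L2dotE fE gE /=.
  have z (r : R -> R) : \int[muO]_x (0 * r x) = 0.
    by under eq_Rintegral do rewrite mul0r; rewrite Rintegral_cst// mul0r.
  rewrite !z !addr0 !sub0r => /eqP; rewrite eq_complex/= -opprD oppr_eq0.
  by move=> /andP[/eqP h1 /eqP h2].
have [p [Dp pU]] := rmaxd_weak_derivative alpha_lt_beta beta_lt_alpha
  (L2fun_Re_measurable U) (L2fun_Re_measurable V)
  (L2fun_Re_integrable U) (L2fun_Re_integrable V)
  (fun phi i a b sm aa bb z0 => (weak phi i a b sm aa bb z0).1).
have [q [Dq qU]] := rmaxd_weak_derivative alpha_lt_beta beta_lt_alpha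
  (L2fun_Im_measurable U) (L2fun_Im_measurable V)
  (L2fun_Im_integrable U) (L2fun_Im_integrable V)
  (fun phi i a b sm aa bb z0 => (weak phi i a b sm aa bb z0).2).
have [f [g [fg fE gE]]] := L2fun_of_rmaxd Dp Dq.
exists f, g; split => //.
- rewrite uE; apply/eq_L2; apply: aeS2 pU qU => x; rewrite fE.
  by case: (U x) => ? ? /= -> ->.
- rewrite vE; congr (_ *: _); apply/eq_L2; apply: aeW => x; rewrite gE.
  by case: (V x).
Qed.

(** Zero boundary values meet the condition of every [B], so this one statement gives the density of
    all the domains [D_B]. *)
Lemma maxd_dense u (e : R) : 0 < e -> exists f g,
  [/\ maxd f g, va f = 0, vb f = 0 &
      Num.sqrt (Re (L2dot muO (u - pi f) (u - pi f))) < e].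
Proof.
move=> e0; have [U uE] : exists U, u = pi U by exists (repr u); rewrite reprK.
(* The squared norm is shared equally between the real and imaginary parts. *)
have e20 : 0 < e ^+ 2 / 2 by rewrite divr_gt0 ?exprn_gt0.
have approx (r : R -> R) := @lipschitz_approximation R n alpha beta alpha_lt_beta beta_lt_alpha r.
have [p [p' [L1 [K1 [d1 [[pK pL] [mp' p'L] dp [d10 p0] ep]]]]]] :=
  approx _ (L2fun_Re_measurable U) (L2fun_Re_integrable U) _ e20.
have [q [q' [L2 [K2 [d2 [[qK qL] [mq' q'L] dq [d20 q0] eq]]]]]] :=
  approx _ (L2fun_Im_measurable U) (L2fun_Im_integrable U) _ e20.
have Dp := rmaxd_lipschitz alpha_lt_beta beta_lt_alpha pK pL mp' p'L dp.
have Dq := rmaxd_lipschitz alpha_lt_beta beta_lt_alpha qK qL mq' q'L dq.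
have [f [g [fg fE _]]] := L2fun_of_rmaxd Dp Dq.
have near0 (r : R -> R) d (c : R) : 0 < d -> ~ Om c ->
    (forall c x, ~ Om c -> `|x - c| < d -> r x = 0) -> \near c, r c = 0.
  by move=> d0 Oc r0; exists d => // x /= xc; apply: (r0 c) => //; rewrite distrC.
exists f, g; split => //.
- apply/colP => i; rewrite !mxE /lim_right fE /=.
  rewrite (near0_ends (near0 _ _ _ d10 (@alpha_notin_Omega _ _ _ _ alpha_lt_beta beta_lt_alpha i) p0)).1.
  by rewrite (near0_ends (near0 _ _ _ d20 (@alpha_notin_Omega _ _ _ _ alpha_lt_beta beta_lt_alpha i) q0)).1.
- apply/colP => i; rewrite !mxE /lim_left fE /=.
  rewrite (near0_ends (near0 _ _ _ d10 (@beta_notin_Omega _ _ _ _ alpha_lt_beta beta_lt_alpha i) p0)).2.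
  by rewrite (near0_ends (near0 _ _ _ d20 (@beta_notin_Omega _ _ _ _ alpha_lt_beta beta_lt_alpha i) q0)).2.
- have -> : u - pi f = pi ((-1) *: f + U) by rewrite pi_lin scaleN1r addrC uE.
  have UfE x : L2val ((-1) *: f + U) x = U x - f x.
    by rewrite -[LHS]/(-1 * f x + U x) mulN1r addrC.
  have dotE k : Re (L2dot muO (pi k) (pi k)) =
      \int[muO]_x (Re (k x) * Re (k x)) + \int[muO]_x (Im (k x) * Im (k x)).
    by rewrite L2dotE.
  rewrite dotE -(ger0_norm (ltW e0)) -sqrtr_sqr ltr_sqrt ?exprn_gt0//.
  rewrite (splitr (e ^+ 2)); apply: ltrD.
  + move: ep; congr (_ < _); apply: eq_Rintegral => x _.
    by rewrite UfE fE; case: (U x) => ? ? /=; ring.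
  + move: eq; congr (_ < _); apply: eq_Rintegral => x _.
    by rewrite UfE fE; case: (U x) => ? ? /=; ring.
Qed.

End momentum_operator.

(** * Correspondence between self-adjoint extensions and unitary matrices *)

Section self_adjoint_extensions.
Context {R : realType} (n : nat) (alpha beta : 'I_n -> R).
Hypothesis alpha_lt_beta : forall i : 'I_n, alpha i < beta i.
Hypothesis beta_lt_alpha : forall i j : 'I_n, j = i.+1 :> nat -> beta i < alpha j.
Local Notation C := R[i].
Local Notation muO := (mu_Omega alpha beta).
Local Notation pi f := (\pi_(L2 muO)%qT f : L2 muO).
Local Notation c0 := (inv_2ipi R).
Local Notation va := (val_alpha alpha).
Local Notation vb := (val_beta beta).
Local Notation D_of B := (restriction (D_star alpha beta) (D_B alpha beta B)).
Implicit Types (f g h k : L2fun muO) (u v : L2 muO) (B : 'M[C]_n).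

(** The representative witnessing [D_star] and the one witnessing [D_B] may differ; [maxd_unique]
    shows that they have the same derivative class. *)
Lemma restriction_maxd B u v : D_of B (u, v) <->
  exists f g, [/\ maxd f g, B *m va f = vb f, u = pi f & v = c0 *: pi g].
Proof.
split=> [[/(D_star_maxd alpha_lt_beta beta_lt_alpha)[f [g [fg uf vg]]] [f1 []]]|].
  move=> /D_maxP[g1 fg1] bf1 uf1; exists f1, g1; split => //.
  by rewrite vg; have [-> //] := maxd_unique alpha_lt_beta beta_lt_alpha fg fg1 (etrans (esym uf) uf1).
move=> [f [g [fg bf uf vg]]]; split.
  by apply/(D_star_maxd alpha_lt_beta beta_lt_alpha); exists f, g.
by exists f; split => //; apply/D_maxP; exists g.
Qed.

(** Moving [c0] out of the second argument produces a minus sign, so the symmetry defect is [c0],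
    which is nonzero, times the boundary form of [green]. *)
Lemma dot_maxd f g h k : maxd f g -> maxd h k ->
  L2dot muO (c0 *: pi g) (pi h) = L2dot muO (pi f) (c0 *: pi k) <->
  cdot (vb f) (vb h) = cdot (va f) (va h).
Proof.
move=> fg hk; rewrite L2dotZl L2dotZr conj_inv_2ipi mulNr.
have E := green alpha_lt_beta beta_lt_alpha fg hk; split.
  move=> /eqP; rewrite -addr_eq0 -mulrDr E mulf_eq0 (negbTE inv_2ipi_neq0)/=.
  by rewrite subr_eq0 => /eqP.
move=> bE; apply/eqP; rewrite -addr_eq0 -mulrDr E bE subrr mulr0 //.
Qed.

Lemma D_op_restriction B : D_op alpha beta `<=` D_of B.
Proof.
move=> [u v] /(D_op_maxd alpha_lt_beta beta_lt_alpha)[f [g [fg af bf uf vg]]].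
by apply/restriction_maxd; exists f, g; split => //; rewrite af bf mulmx0.
Qed.

Lemma adjoint_D_star (A : set (L2 muO * L2 muO)) : D_op alpha beta `<=` A ->
  adjoint (L2dot muO) A `<=` D_star alpha beta.
Proof. by move=> DA p Ap q /DA; exact: Ap. Qed.

Lemma self_adjoint_restriction B : B \is unitarymx -> self_adjoint (L2dot muO) (D_of B).
Proof.
move=> uB; split; first split.
- have [f [g [fg af bf]]] := val_surj alpha_lt_beta beta_lt_alpha 0 0.
  have [fg' af' bf'] := maxd_comb alpha_lt_beta beta_lt_alpha (-1) fg fg.
  apply/restriction_maxd; exists (-1 *: f + f), (-1 *: g + g); split => //.
  + by rewrite af' bf' af bf scaler0 addr0 mulmx0.
  + by rewrite pi_lin scaleN1r addNr.
  + by rewrite pi_lin scaleN1r addNr scaler0.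
- move=> c [u v] [u1 v1] /restriction_maxd[f [g [fg Bf -> ->]]].
  move=> /restriction_maxd[h [k [hk Bh -> ->]]].
  have [fg' af' bf'] := maxd_comb alpha_lt_beta beta_lt_alpha c fg hk.
  apply/restriction_maxd; exists (c *: f + h), (c *: g + k); split => //.
  + by rewrite af' bf' mulmxDr -scalemxAr Bf Bh.
  + by rewrite pi_lin.
  + by rewrite /= pi_lin scalerDr !scalerA mulrC.
- move=> u v w /restriction_maxd[f [g [fg _ uf ->]]] /restriction_maxd[h [k [hk _ uh ->]]].
  by have [-> _ _] := maxd_unique alpha_lt_beta beta_lt_alpha fg hk (etrans (esym uf) uh).
- move=> u e e0.
  have [f [g [fg af bf lt_e]]] := maxd_dense alpha_lt_beta beta_lt_alpha u e0.
  exists (pi f) => //; exists (c0 *: pi g); apply/restriction_maxd.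
  by exists f, g; split => //; rewrite af bf mulmx0.
- apply/seteqP; split => -[u v]; last first.
    move=> /restriction_maxd[h [k [hk Bh -> ->]]] [u1 v1].
    move=> /restriction_maxd[f [g [fg Bf -> ->]]] /=.
    by apply/(dot_maxd fg hk); rewrite -Bf -Bh cdot_unitary.
  move=> adj.
  have /(D_star_maxd alpha_lt_beta beta_lt_alpha)[h [k [hk uh vk]]] :=
    adjoint_D_star (@D_op_restriction B) adj.
  apply/restriction_maxd; exists h, k; split => //.
  (* Testing against a function with boundary values [a] and [B *m a], for arbitrary [a], shows that
     the adjoint of [B] sends [vb h] to [va h]; unitarity then inverts this relation. *)
  have E a : cdot a (map_mx Num.conj (trmx B) *m vb h) = cdot a (va h).
    have [f [g [fg af bf]]] := val_surj alpha_lt_beta beta_lt_alpha a (B *m a).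
    rewrite -cdot_adjoint -{1}bf -af; apply/(dot_maxd fg hk).
    have := adj (pi f, c0 *: pi g); rewrite /= uh vk; apply.
    by apply/restriction_maxd; exists f, g; split => //; rewrite af bf.
  have E0 : map_mx Num.conj (trmx B) *m vb h = va h.
    apply/eqP; rewrite -subr_eq0; apply/eqP/cdot_eq0.
    by rewrite cdotBr E subrr.
  by rewrite -E0 mulmxA (unitarymxP uB) mul1mx.
Qed.

(** [W] collects the boundary values of elements of [A]. As [A] equals its adjoint, an element of
    [D_star] lies in [A] exactly when its boundary values are orthogonal to [W]; since all boundary
    values occur, [W] is its own orthogonal and [isotropic_unitary] applies. *)
Lemma self_adjoint_extension (A : set (L2 muO * L2 muO)) :
  self_adjoint (L2dot muO) A -> D_op alpha beta `<=` A ->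
  exists2 B, B \is unitarymx & A = D_of B.
Proof.
move=> [[A0 Alin _] _ adjA] DA.
have AD : A `<=` D_star alpha beta by rewrite -{1}adjA; exact: adjoint_D_star.
pose W a b := exists f g, [/\ maxd f g, A (pi f, c0 *: pi g), va f = a & vb f = b].
have AW h k : maxd h k -> A (pi h, c0 *: pi k) <->
    forall a b, W a b -> cdot b (vb h) = cdot a (va h).
  move=> hk; split.
    rewrite -{1}adjA => Ahk a b [f [g [fg Af <- <-]]].
    by apply/(dot_maxd fg hk); exact: (Ahk _ Af).
  move=> Wh; rewrite -adjA => -[u v] Auv.
  have /(D_star_maxd alpha_lt_beta beta_lt_alpha)[f [g [fg uf vg]]] := AD _ Auv.
  rewrite /= uf vg; apply/(dot_maxd fg hk); apply: Wh; exists f, g; split => //.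
  by rewrite -uf -vg.
have WP a b : W a b <-> forall a1 b1, W a1 b1 -> cdot b1 b = cdot a1 a.
  split=> [[f [g [fg Af <- <-]]]|Wab]; first exact: (AW _ _ fg).1 Af.
  have [f [g [fg af bf]]] := val_surj alpha_lt_beta beta_lt_alpha a b.
  by exists f, g; split => //; apply/(AW _ _ fg) => a1 b1 /Wab; rewrite af bf.
have [|c a b a1 b1||B uB WB] := @isotropic_unitary C n W.
- by apply/WP => a b _; rewrite /cdot !big1// => i _; rewrite mxE conjC0 mulr0.
- move=> [f [g [fg Af <- <-]]] [h [k [hk Ah <- <-]]].
  have [fg' af' bf'] := maxd_comb alpha_lt_beta beta_lt_alpha c fg hk.
  exists (c *: f + h), (c *: g + k); split => //.
  have -> : (pi (c *: f + h), c0 *: pi (c *: g + k)) =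
      c *: (pi f, c0 *: pi g) + (pi h, c0 *: pi k).
    by rewrite !pi_lin scalerDr scalerA mulrC -scalerA.
  exact: Alin.
- exact: WP.
exists B => //; apply/seteqP; split => -[u v].
  move=> Auv; have /(D_star_maxd alpha_lt_beta beta_lt_alpha)[f [g [fg uf vg]]] := AD _ Auv.
  apply/restriction_maxd; exists f, g; split => //.
  by apply/esym/WB; exists f, g; split => //; rewrite -uf -vg.
move=> /restriction_maxd[f [g [fg /esym/WB Wf -> ->]]].
by apply/(AW _ _ fg); apply/WP.
Qed.

(** A function with boundary values [a] and [B *m a] satisfies the condition for [B], hence the one
    for [B1], and its boundary values do not depend on the representative. *)
Lemma restriction_inj B B1 : D_of B = D_of B1 -> B = B1.
Proof.
move=> BB; apply: mulmx_inj => a.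
have [f [g [fg af bf]]] := val_surj alpha_lt_beta beta_lt_alpha a (B *m a).
have : D_of B (pi f, c0 *: pi g).
  by apply/restriction_maxd; exists f, g; split => //; rewrite af bf.
rewrite BB => /restriction_maxd[h [k [hk Bh fh _]]].
have [_ eva evb] := maxd_unique alpha_lt_beta beta_lt_alpha fg hk fh.
by rewrite -bf evb -Bh -eva af.
Qed.

End self_adjoint_extensions.


Theorem theorem3p7 (R : realType) (n : nat) (alpha beta : 'I_n -> R)
  (n_gt0 : (0 < n)%N)
  (alpha_lt_beta : forall i : 'I_n, alpha i < beta i)
  (beta_lt_alpha : forall i j : 'I_n, j = i.+1 :> nat -> beta i < alpha j) :
  (forall A : set (L2 (mu_Omega alpha beta) * L2 (mu_Omega alpha beta)),
    self_adjoint (L2dot (mu_Omega alpha beta)) A ->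
    D_op alpha beta `<=` A ->
    exists! B : 'M[R[i]]_n, B \is unitarymx /\
      A = restriction (D_star alpha beta) (D_B alpha beta B)) /\
  (forall B : 'M[R[i]]_n, B \is unitarymx ->
    self_adjoint (L2dot (mu_Omega alpha beta))
      (restriction (D_star alpha beta) (D_B alpha beta B)) /\
    D_op alpha beta `<=` restriction (D_star alpha beta) (D_B alpha beta B)).
Proof.
split=> [A saA DA|B uB]; last first.
  split; first exact: self_adjoint_restriction.
  exact: D_op_restriction.
have [B uB AB] := self_adjoint_extension alpha_lt_beta beta_lt_alpha saA DA.
exists B; split => // B1 [_ AB1].
by apply: (restriction_inj alpha_lt_beta beta_lt_alpha); rewrite -AB -AB1.
Qed.
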